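(* Let $g$ be a positive odd prime and let $E/\mathbb{Q}$ be the elliptic curve defined by $y^2=x^3-gx$. For each even integer $r$ with $g\nmid r$, the Hardy--Littlewood conjecture (HL) implies $$\pi_{E,r}(x)\sim\frac14\cdot\Big\{1+\frac{\delta_{g,r}}{g-1-(\frac{-1}{g})}\Big\}\cdot\prod_{p\nmid r}\Big(1-\frac{(\frac{-1}{p})}{p-1}\Big)\cdot\frac{\sqrt x}{\log x},$$ where $$\delta_{g,r}=\begin{cases}1,& 4\mid r,\\ -1,& r\equiv2\ (\mathrm{mod}\ 4),\ g\equiv1\ (\mathrm{mod}\ 4),\\ -1-2(-1)^{\frac{r-2}{4}+\frac{g+1}{4}},& r\equiv2\ (\mathrm{mod}\ 4),\ g\equiv3\ (\mathrm{mod}\ 4).\end{cases}$$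
   Context: For $E/\mathbb{Q}$ of conductor $N_E$ and $p\nmid N_E$, $a_p(E)=p+1-|E_p(\mathbb{F}_p)|$, $\pi_{E,r}(x)=|\{p\leqslant x: p\nmid N_E,\ a_p(E)=r\}|$. $(\frac{\cdot}{p})$ is the Legendre symbol; infinite products over primes are in increasing order. If the constant is $0$, the asymptotic formula is interpreted as $\pi_{E,r}(x)=O(1)$. (HL): for all $a,b,c\in\mathbb{Z}$ with $a>0$, $b^2-4ac$ not a square, $\gcd(a,b,c)=1$, and $a+b$, $c$ not both even, the number $\pi_{a,b,c}(x)$ of primes $p\leqslant x$ of the form $am^2+bm+c$, $m\in\mathbb{Z}_{\geqslant1}$, satisfies $\pi_{a,b,c}(x)\sim\frac{\gcd(2,a+b)}{\sqrt a}\frac{\Delta}{\varphi(\Delta)}\prod_{p\nmid2a}\Big(1-\frac{(\frac{b^2-4ac}{p})}{p-1}\Big)\frac{\sqrt x}{\log x}$, $\Delta$ being the odd part of $\gcd(a,b)$. *)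

(* Defs.v *)
(* Written for MathComp and MathComp-Analysis. *)
From HB Require Import structures.
From mathcomp Require Import all_boot all_order all_algebra.
From mathcomp Require Import all_classical all_reals all_analysis.

Set Implicit Arguments.
Unset Strict Implicit.
Unset Printing Implicit Defensive.

Import Order.TTheory GRing.Theory Num.Theory.
Import numFieldNormedType.Exports.

Local Open Scope ring_scope.

(* The equation y^2 + a1 x y + a3 y = x^3 + a2 x^2 + a4 x + a6. *)
Record weierstrass (R : Type) := Weierstrass
  { wa1 : R; wa2 : R; wa3 : R; wa4 : R; wa6 : R }.

Definition map_weierstrass (R S : Type) (f : R -> S) (W : weierstrass R) :
    weierstrass S :=
  Weierstrass (f (wa1 W)) (f (wa2 W)) (f (wa3 W)) (f (wa4 W)) (f (wa6 W)).

Definition on_weierstrass (R : comNzRingType) (W : weierstrass R) (x y : R) :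
    bool :=
  y ^+ 2 + wa1 W * x * y + wa3 W * y
    == x ^+ 3 + wa2 W * x ^+ 2 + wa4 W * x + wa6 W.

Definition weierstrass_disc (R : comNzRingType) (W : weierstrass R) : R :=
  let b2 := wa1 W ^+ 2 + 4 * wa2 W in
  let b4 := 2 * wa4 W + wa1 W * wa3 W in
  let b6 := wa3 W ^+ 2 + 4 * wa6 W in
  let b8 := wa1 W ^+ 2 * wa6 W + 4 * wa2 W * wa6 W - wa1 W * wa3 W * wa4 W
            + wa2 W * wa3 W ^+ 2 - wa4 W ^+ 2 in
  - b2 ^+ 2 * b8 - 8 * b4 ^+ 3 - 27 * b6 ^+ 2 + 9 * b2 * b4 * b6.

(* W' is obtained from W by substituting x := u^2 x + r and
   y := u^3 y + s u^2 x + t and then dividing the equation by u^6. *)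
Definition weierstrass_iso (F : fieldType) (W W' : weierstrass F) : Prop :=
  exists u r s t : F,
    [/\ u != 0,
        u * wa1 W' = wa1 W + 2 * s,
        u ^+ 2 * wa2 W' = wa2 W - s * wa1 W + 3 * r - s ^+ 2,
        u ^+ 3 * wa3 W' = wa3 W + r * wa1 W + 2 * t &
        u ^+ 4 * wa4 W' = wa4 W - s * wa3 W + 2 * r * wa2 W
                          - (t + r * s) * wa1 W + 3 * r ^+ 2 - 2 * s * t /\
        u ^+ 6 * wa6 W' = wa6 W + r * wa4 W + r ^+ 2 * wa2 W + r ^+ 3
                          - t * wa3 W - t ^+ 2 - r * t * wa1 W].

(* W is an integral equation of E whose reduction modulo p is nonsingular. *)
Definition good_model (E : weierstrass rat) (p : nat) (W : weierstrass int) :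
    Prop :=
  weierstrass_iso E (map_weierstrass intr W) /\
  ~~ (p%:Z %| weierstrass_disc W)%Z.

(* For p prime this says that p does not divide the conductor of E: the primes
   dividing the conductor are exactly the primes of bad reduction. *)
Definition good_reduction (E : weierstrass rat) (p : nat) : Prop :=
  exists W : weierstrass int, good_model E p W.

(* p + 1 - #W(F_p); the summand 1 in the point count is the point at
   infinity.  Meaningful for p prime, as 'F_p is then Z/pZ. *)
Definition trace_model (W : weierstrass int) (p : nat) : int :=
  let Wp : weierstrass 'F_p := map_weierstrass intr W in
  p%:Z + 1
    - (1 + #|[set P : 'F_p * 'F_p | on_weierstrass Wp P.1 P.2]|)%N%:Z.

(* a_p(E).  E_p is the reduction of an integral equation of E with good
   reduction at p; which one is immaterial, since any two of them are
   isomorphic over the localization of Z at p. *)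
Definition frobenius_trace (E : weierstrass rat) (p : nat) : int :=
  if pselect (good_reduction E p) is left ex
  then trace_model (projT1 (cid ex)) p else 0.

Canonical pinfty_filter_on (R : numFieldType) :=
  FilterType (pinfty_nbhs R) (@filter_filter R _ _).

Local Notation infty := (pinfty_nbhs _).

(* The number of primes p <= x satisfying P; for x < 0, Num.truncn x = 0. *)
Definition prime_count (R : realType) (P : nat -> Prop) (x : R) : nat :=
  count (fun p => prime p && `[< P p >]) (iota 0 (Num.truncn x).+1).

(* pi_{E,r}(x) *)
Definition pi_trace (R : realType) (E : weierstrass rat) (r : int) (x : R) :
    nat :=
  prime_count (fun p => good_reduction E p /\ frobenius_trace E p = r) x.

(* pi_{a,b,c}(x) *)
Definition pi_quad (R : realType) (a b c : int) (x : R) : nat :=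
  prime_count (fun p => exists m : int,
    (1 <= m) /\ p%:Z = a * m ^+ 2 + b * m + c) x.

(* The Legendre symbol, for p an odd prime. *)
Definition legendre (a : int) (p : nat) : int :=
  if (p%:Z %| a)%Z then 0
  else if [exists x : 'I_p, (x%:Z ^+ 2 == a %[mod p%:Z])%Z] then 1
  else -1.

(* The product over all primes p satisfying A of F p, in increasing order of p
   (conditional convergence is allowed). *)
Definition prime_prod (R : realType) (A : pred nat) (F : nat -> R) : R :=
  limn (fun n : nat => \prod_(0 <= p < n | prime p && A p) F p).

Definition sqrt_log (R : realType) (x : R) : R := Num.sqrt x / ln x.

Definition HL_const (R : realType) (a b c : int) : R :=
  let D := ((gcdn `|a| `|b|)`_(2^'))%N in
  (gcdn 2 `|a + b|)%:R / Num.sqrt a%:~R * (D%:R / (totient D)%:R)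
  * prime_prod (fun p => ~~ (p%:Z %| 2 * a)%Z)
      (fun p => 1 - (legendre (b ^+ 2 - 4 * a * c) p)%:~R / (p%:R - 1)).

Definition HL (R : realType) : Prop :=
  forall a b c : int,
    0 < a ->
    ~ (exists n : int, b ^+ 2 - 4 * a * c = n ^+ 2) ->
    gcdz (gcdz a b) c = 1 ->
    ~~ ((2 %| a + b)%Z && (2 %| c)%Z) ->
    (fun x : R => (pi_quad a b c x)%:R : R)
      ~_infty (fun x : R => HL_const R a b c * sqrt_log x).

(* f(x) ~ C sqrt x / log x, interpreted as f(x) = O(1) when C = 0. *)
Definition asymp_sqrt_log (R : realType) (f : R -> R) (C : R) : Prop :=
  if C == 0 then f =O_infty (fun _ : R => 1 : R)
  else f ~_infty (fun x : R => C * sqrt_log x).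

(* y^2 = x^3 - g x *)
Definition curve_E (g : nat) : weierstrass rat :=
  Weierstrass 0 0 0 (- g%:R) 0.

(* Only meaningful for r even.  The divisions by 4 are exact in the branch
   where they occur; the exponent may be negative. *)
Definition delta (g : nat) (r : int) : int :=
  if (4 %| r)%Z then 1
  else if (g %% 4 == 1)%N then -1
  else -1 - 2 * (-1) ^ (((r - 2) %/ 4)%Z + ((g%:Z + 1) %/ 4)%Z).

(* Main.v *)
(* Put r = 2 s.  If p = 3 mod 4 the trace vanishes.  If p = 1 mod 4, let chi be
   a quartic character mod p and pi = -J(chi, phi), a primary Gaussian integer
   of norm p; the trace is 2 Re(conj(chi(g)) pi), so trace 2 s forces
   p = s^2 + m^2.  Raising the Gauss sum of chi to the g-th power in an algebraic
   closure of F_g expresses chi(g) by ((s + i m)/(s - i m))^(n/4), where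
   n = g - (-1/g): for p = s^2 + m^2 with m >= 1, having trace 2 s depends only on
   m mod 4 g.  As u runs through F_g, (s + i u)/(s - i u) runs through the n-th
   roots of unity except -1, so exactly (n - 1 + delta)/2 classes are
   admissible.  (HL) applied to (4 g k + t)^2 + s^2 gives each class the same
   constant, namely 1/(2(g - 1)) times the product over the primes not dividing
   2 g s. *)
Require Import Defs.
From HB Require Import structures.
From mathcomp Require Import all_boot all_order all_algebra all_field.
From mathcomp Require Import all_classical all_reals all_analysis.
From mathcomp Require Import ring zify.

Import Order.TTheory GRing.Theory Num.Theory.
Import numFieldNormedType.Exports.

Local Open Scope ring_scope.

(** The obstacle is that p = s^2 + m^2 fixes the Gaussian integer pi only up to signs, conjugation
    and the exchange of s and m, while chi depends on a chosen primitive root. The congruence pi = 1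
    modulo 2 + 2i, together with the effect of these eight symmetries on ((s + i m)/(s - i
    m))^(n/4), cancels the choices; this is why the criterion can be stated in s and m alone.
    Characteristic g suits reciprocity because x -> x^g is additive there: it acts on a Gauss sum
    term by term, and it fixes integers, so that pi^g is pi or its conjugate according to i^g = i or
    -i. For this purpose pi is kept as a pair of integers, whose norm is computed over the complex
    numbers and then read in characteristic g. Finitely many p, those with m < 4 g among them, may
    escape the classes with k >= 1. They change the count by O(1), which is negligible against sqrt
    x / log x and is all that remains when no class is admissible. *)

(** * Discrete logarithms and the quadratic character of F_p *)

Lemma eqmod_dvd {d n a b : nat} : (d %| n)%N -> a = b %[mod n] -> a = b %[mod d].
Proof. by move=> dn E; rewrite -(modn_dvdm a dn) E modn_dvdm. Qed.

Lemma Fp_prim_root {p : nat} : prime p ->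
  exists h : 'F_p, (p.-1).-primitive_root h.
Proof.
move=> p_pr; have p1 := prime_gt1 p_pr.
have /hasP[h _ hP] : has (p.-1).-primitive_root (enum (predC1 (0 : 'F_p))).
  apply: cyclic.has_prim_root; rewrite ?enum_uniq //; first by lia.
  - apply/allP => x; rewrite mem_enum inE => x0; rewrite unity_rootE.
    rewrite -(inj_eq (mulfI x0)) -exprS prednK ?mulr1; last by lia.
    by rewrite -[X in x ^+ X](card_Fp p_pr) expf_card.
  - by rewrite -cardE cardC1 card_Fp.
by exists h.
Qed.

Definition dlog {p : nat} (h x : 'F_p) : nat :=
  if [pick i : 'I_p.-1 | x == h ^+ i] is Some i then i else 0.

(* The k-th power of the quartic character of F_p that sends h to I; for k = 2
   this is the quadratic character phi below. *)
Definition psi {p : nat} (h : 'F_p) {F : fieldType} (I : F) (k : nat)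
  (x : 'F_p) : F := if x == 0 then 0 else I ^+ (k * dlog h x).

(** Integer values allow the same character sum to be read in [algC] and in characteristic g. *)
Definition phi {p : nat} (x : 'F_p) : int :=
  if x == 0 then 0 else if [exists y, y ^+ 2 == x] then 1 else -1.

Lemma Fp_neq_opp {p : nat} (p_pr : prime p) (p_odd : odd p) (y : 'F_p) : y != 0 -> y != - y.
Proof.
move=> y0; rewrite -addr_eq0 -mulr2n -mulr_natr mulf_neq0 //.
have p1 := prime_gt1 p_pr.
rewrite -(dvdn_pcharf (pchar_Fp p_pr)).
by apply/negP => /(dvdn_leq (isT : 0 < 2)%N); lia.
Qed.

Lemma card_sqrt {p : nat} (p_pr : prime p) (p_odd : odd p) (c : 'F_p) :
  (#|[set y : 'F_p | y ^+ 2 == c]|%:Z = 1 + phi c)%R.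
Proof.
rewrite /phi; case: eqP => [-> | /eqP c0].
  rewrite (_ : [set _ | _] = [set 0]) ?cards1 //.
  by apply/setP => y; rewrite !inE expf_eq0.
case: existsP => [[y /eqP yc] | nc].
  rewrite (_ : [set _ | _] = [set y; - y]).
    rewrite cards2 Fp_neq_opp //.
    by apply: contra_neq c0 => y0; rewrite -yc y0 expr0n.
  by apply/setP => z; rewrite !inE -yc eqf_sqr.
rewrite (_ : [set _ | _] = finset.set0) ?cards0 //.
by apply/setP => y; rewrite !inE; apply/negP => yc; apply: nc; exists y.
Qed.

Section DiscreteLog.

Context {p : nat} {h : 'F_p} (p_pr : prime p)
  (hP : (p.-1).-primitive_root h).

Lemma dlogK (x : 'F_p) : x != 0 -> h ^+ dlog h x = x.
Proof.
move=> x0; have p1 := prime_gt1 p_pr.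
have xp : x ^+ p.-1 = 1.
  apply/eqP; rewrite -(inj_eq (mulfI x0)) -exprS prednK ?mulr1; last by lia.
  by rewrite -[X in x ^+ X](card_Fp p_pr) expf_card.
have [i xi] := prim_rootP hP xp.
rewrite /dlog; case: pickP => [j /eqP // | /(_ i)].
by rewrite xi eqxx.
Qed.

Lemma prim_root_neq0 k : h ^+ k != 0.
Proof.
have p1 := prime_gt1 p_pr.
apply: expf_neq0; apply: contra_eq_neq (prim_expr_order hP) => ->.
by rewrite expr0n; case: (p.-1 =P 0)%N => [|_]; [lia | rewrite eq_sym oner_eq0].
Qed.

Lemma dlogX k : dlog h (h ^+ k) = k %[mod p.-1].
Proof.
by apply/eqP; rewrite -(eq_prim_root_expr hP) dlogK // prim_root_neq0.
Qed.

Lemma dlogM (x y : 'F_p) : x != 0 -> y != 0 ->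
  dlog h (x * y) = (dlog h x + dlog h y)%N %[mod p.-1].
Proof.
by move=> x0 y0; rewrite -{1}(dlogK x x0) -{1}(dlogK y y0) -exprD dlogX.
Qed.

Context (p_odd : odd p).

Lemma Fp_neg1 : h ^+ p.-1./2 = -1.
Proof.
have p1 := prime_gt1 p_pr; apply/eqP.
have : (h ^+ p.-1./2) ^+ 2 == 1 ^+ 2.
  rewrite expr1n -exprM; have -> : (p.-1./2 * 2 = p.-1)%N by lia.
  by rewrite (prim_expr_order hP).
rewrite eqf_sqr => /orP[|//].
by rewrite -(expr0 h) (eq_prim_root_expr hP) mod0n modn_small; lia.
Qed.

Lemma sqr_dlog (x : 'F_p) : x != 0 ->
  [exists y, y ^+ 2 == x] = ~~ odd (dlog h x).
Proof.
move=> x0; have p1 := prime_gt1 p_pr; apply/existsP/idP => [[y /eqP yx] | xe].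
  have y0 : y != 0 by apply: contra_neq x0 => y0; rewrite -yx y0 expr0n.
  have := dlogM y y y0 y0; rewrite -expr2 yx => E.
  have p2 : (2 %| p.-1)%N by rewrite dvdn2; lia.
  by have := eqmod_dvd p2 E; rewrite !modn2; lia.
exists (h ^+ (dlog h x)./2); rewrite -exprM.
by have -> : ((dlog h x)./2 * 2 = dlog h x)%N; [lia | rewrite dlogK].
Qed.

(** Here -1 = h^((p-1)/2) has an odd logarithm, so it is not a square. *)
Lemma phiN (c : 'F_p) : (p %% 4 = 3)%N -> phi (- c) = - phi c.
Proof.
move=> p3; have p1 := prime_gt1 p_pr.
rewrite /phi oppr_eq0; case: eqP => [//|/eqP c0].
have cN0 : - c != 0 by rewrite oppr_eq0.
have N10 : -1 != 0 :> 'F_p by rewrite oppr_eq0 oner_eq0.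
rewrite !sqr_dlog //.
have : dlog h (- c) = (p.-1./2 + dlog h c)%N %[mod 2].
  have E1 : dlog h (-1) = p.-1./2 %[mod p.-1] by rewrite -Fp_neg1 dlogX.
  have E := dlogM (-1) c N10 c0.
  rewrite mulN1r -modnDml E1 modnDml in E.
  by apply: eqmod_dvd E; rewrite dvdn2; lia.
have p4 : odd p.-1./2 by lia.
by rewrite !modn2 oddD p4; case: (odd (dlog h c)); case: (odd _).
Qed.

End DiscreteLog.

(** * Gauss and Jacobi sums of a quartic character *)

(* i^n = re4 n + im4 n * i. *)
Definition re4 (n : nat) : int :=
  match (n %% 4)%N with 0%N => 1 | 2%N => -1 | _ => 0 end.
Definition im4 (n : nat) : int :=
  match (n %% 4)%N with 1%N => 1 | 3%N => -1 | _ => 0 end.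

Section SqrtN1.

Context {F : fieldType} {I : F} (I2 : I ^+ 2 = -1).

Lemma sqrtN1_expr4 : I ^+ 4 = 1.
Proof. by rewrite (exprM I 2 2) I2 sqrrN expr1n. Qed.

Lemma sqrtN1_neq0 : I != 0.
Proof.
by apply: contra_eq_neq I2 => ->; rewrite expr0n eq_sym oppr_eq0 oner_eq0.
Qed.

Lemma sqrtN1_mod {a b : nat} : a = b %[mod 4] -> I ^+ a = I ^+ b.
Proof.
by move=> E; rewrite -(expr_mod a sqrtN1_expr4) E (expr_mod b sqrtN1_expr4).
Qed.

Lemma sqrtN1_expr n : I ^+ n = (re4 n)%:~R + (im4 n)%:~R * I.
Proof.
rewrite -(expr_mod n sqrtN1_expr4) /re4 /im4.
have : (n %% 4 < 4)%N by rewrite ltn_pmod.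
case: (n %% 4)%N => [|[|[|[|//]]]] _; rewrite ?expr0 ?expr1 ?exprS ?I2 ?expr0;
  rewrite ?mulrNz ?mulr0z ?mulr1z; ring: I2.
Qed.

End SqrtN1.

Section QuarticCharacter.

Context {p : nat} {h : 'F_p} (p_pr : prime p) (p4 : (p %% 4 = 1)%N)
  (hP : (p.-1).-primitive_root h).
Let p_odd : odd p. Proof. lia. Qed.

Context {F : fieldType} {I : F} (I2 : I ^+ 2 = -1) (F2 : 2 != 0 :> F).

Local Notation psi := (@psi p h F I).

Lemma psi0 k : psi k 0 = 0.
Proof. by rewrite /psi eqxx. Qed.

Lemma psiE k x : x != 0 -> psi k x = I ^+ (k * dlog h x).
Proof. by rewrite /psi => /negPf ->. Qed.

Lemma psiM k x y : psi k (x * y) = psi k x * psi k y.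
Proof.
have [->|x0] := eqVneq x 0; first by rewrite mul0r psi0 mul0r.
have [->|y0] := eqVneq y 0; first by rewrite mulr0 psi0 mulr0.
rewrite !psiE ?mulf_neq0 // -exprD; apply: (sqrtN1_mod I2).
have p41 : (4 %| p.-1)%N by have := prime_gt1 p_pr; lia.
have E := eqmod_dvd p41 (dlogM p_pr hP x y x0 y0).
by rewrite -mulnDr -modnMmr E modnMmr.
Qed.

Lemma psiD j k x : psi j x * psi k x = psi (j + k) x.
Proof.
have [->|x0] := eqVneq x 0; first by rewrite !psi0 mul0r.
by rewrite !psiE // -exprD mulnDl.
Qed.

Lemma psi_mod {j k} x : j = k %[mod 4] -> psi j x = psi k x.
Proof.
move=> E; have [->|x0] := eqVneq x 0; first by rewrite !psi0.
by rewrite !psiE //; apply: (sqrtN1_mod I2); rewrite -modnMml E modnMml.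
Qed.

Lemma psi_neq0 k x : x != 0 -> psi k x != 0.
Proof. by move=> x0; rewrite psiE // expf_neq0 // (sqrtN1_neq0 I2). Qed.

Lemma psi4 k x : k = 0 %[mod 4] -> psi k x = (x != 0)%:R.
Proof.
move=> /(psi_mod x) ->; have [->|x0] := eqVneq x 0; first by rewrite psi0.
by rewrite psiE.
Qed.

Lemma psi2N1 : psi 2 (-1) = 1.
Proof.
have -> : -1 = h ^+ (p.-1 %/ 4) * h ^+ (p.-1 %/ 4).
  rewrite -exprD -(Fp_neg1 p_pr hP p_odd); congr (_ ^+ _).
  by have := prime_gt1 p_pr; lia.
have h0 := prim_root_neq0 p_pr hP.
by rewrite psiM psiD psi4 // h0.
Qed.

Lemma psi1N1 : psi 1 (-1) = (-1) ^+ (p.-1 %/ 4).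
Proof.
have p1 := prime_gt1 p_pr.
have p41 : (4 %| p.-1)%N by lia.
rewrite psiE ?oppr_eq0 ?oner_eq0 // mul1n -(Fp_neg1 p_pr hP p_odd) -I2 -exprM.
apply: (sqrtN1_mod I2); rewrite (eqmod_dvd p41 (dlogX p_pr hP _)).
by congr (_ %% _)%N; lia.
Qed.

Lemma phi_psi x : (phi x)%:~R = psi 2 x :> F.
Proof.
rewrite /phi; have [->|x0] := eqVneq x 0; first by rewrite psi0.
rewrite (sqr_dlog p_pr hP p_odd) // psiE // exprM I2 -signr_odd.
by case: odd.
Qed.

Lemma psi_gen k : psi k h = I ^+ k.
Proof.
have p1 := prime_gt1 p_pr.
have p41 : (4 %| p.-1)%N by lia.
have h0 := prim_root_neq0 p_pr hP 1; rewrite expr1 in h0.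
rewrite psiE //; apply: (sqrtN1_mod I2).
have := eqmod_dvd p41 (dlogX p_pr hP 1); rewrite expr1 => E.
by rewrite -modnMmr E modnMmr muln1.
Qed.

Lemma sqrtN1_neq1 {k} : (k %% 4 != 0)%N -> I ^+ k != 1.
Proof.
move=> k0; rewrite -(expr_mod k (sqrtN1_expr4 I2)).
have N1 : -1 != 1 :> F by rewrite -subr_eq0 -opprD oppr_eq0.
have : (k %% 4 < 4)%N by rewrite ltn_pmod.
case: (k %% 4)%N k0 => [|[|[|[|//]]]] // _ _; rewrite ?I2 // ?expr1.
  by apply: contra_neq N1 => I1; rewrite -I2 I1 expr1n.
apply: contra_neq N1 => I3.
have : (I ^+ 3) ^+ 2 = -1 by rewrite -exprM (exprM I 2 3) I2; ring.
by rewrite I3 expr1n.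
Qed.

Lemma sum_psi {k} : (k %% 4 != 0)%N -> \sum_x psi k x = 0.
Proof.
move=> k0; have h0 := prim_root_neq0 p_pr hP 1; rewrite expr1 in h0.
have : \sum_x psi k x = I ^+ k * \sum_x psi k x.
  rewrite {1}(reindex_inj (mulfI h0)) /= big_distrr.
  by apply: eq_bigr => x _; rewrite psiM psi_gen.
move/eqP; rewrite -subr_eq0 -{1}[\sum_x _]mul1r -mulrBl mulf_eq0 subr_eq0 eq_sym.
by rewrite (negPf (sqrtN1_neq1 k0)) => /eqP.
Qed.

Definition jacobi k : F := \sum_x psi k x * psi 2 (1 - x).

(** Since phi = chi^2, phi(x (x^2 - D)) = chi(x^2) phi(x^2 - D) depends only on y = x^2. Each y has
    1 + phi(y) square roots, which produces the weight chi(y) + chi^3(y); the scaling y = D z then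
    yields two Jacobi sums. *)
Lemma sum_cubic (D : 'F_p) : D != 0 ->
  \sum_x psi 2 (x ^+ 3 - D * x) = psi 3 D * jacobi 1 + psi 1 D * jacobi 3.
Proof.
move=> D0.
have psi2N z : psi 2 (z - 1) = psi 2 (1 - z).
  have -> : z - 1 = -1 * (1 - z) by ring.
  by rewrite psiM psi2N1 mul1r.
transitivity (\sum_y (psi 1 y + psi 3 y) * psi 2 (y - D)).
  rewrite (partition_big (fun x => x ^+ 2) predT) //=.
  apply: eq_bigr => y _.
  have -> : psi 1 y + psi 3 y = psi 1 y * (#|[set x : 'F_p | x ^+ 2 == y]|%:Z)%:~R.
    rewrite (card_sqrt p_pr p_odd) rmorphD /= phi_psi mulrDr mulr1.
    by rewrite psiD.
  rewrite mulrAC (_ : _%:~R = \sum_(x | x ^+ 2 == y) (1 : F)).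
    rewrite big_distrr /=; apply: eq_bigr => x /eqP xy.
    have -> : x ^+ 3 - D * x = x * (y - D) by rewrite -xy; ring.
    by rewrite psiM mulr1 -[in psi 1 _]xy expr2 psiM psiD.
  by rewrite sumr_const cardsE.
rewrite (reindex_inj (mulfI D0)) /= /jacobi !big_distrr -big_split /=.
apply: eq_bigr => z _.
have -> : D * z - D = D * (z - 1) by ring.
rewrite !psiM psi2N mulrDl; congr (_ + _).
  by rewrite -(psiD 1 2 D); ring.
have -> : psi 1 D = psi 3 D * psi 2 D by rewrite psiD; apply: psi_mod.
by ring.
Qed.

Section GaussSums.

Context {z : F} (zP : p.-primitive_root z).

Definition zexp (x : 'F_p) : F := z ^+ (x : nat).

Definition gauss k : F := \sum_x psi k x * zexp x.

Lemma zexpD (x y : 'F_p) :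
  zexp (x + y) = zexp x * zexp y.
Proof.
rewrite /zexp -exprD -(prim_expr_mod zP (x + y)); congr (_ ^+ _).
by congr (_ %% _)%N; apply: Fp_cast.
Qed.

Lemma zexp_nat (n : nat) : zexp n%:R = z ^+ n.
Proof. by rewrite /zexp val_Fp_nat // (prim_expr_mod zP). Qed.

Lemma sum_prim_root (c : 'F_p) :
  \sum_(y : 'F_p) zexp (c * y) = if c == 0 then p%:R else 0.
Proof.
case: eqP => [-> | /eqP c0].
  under eq_bigr do rewrite mul0r (zexp_nat 0) expr0.
  by rewrite sumr_const card_Fp.
rewrite -(reindex_inj (mulfI c0) (P := predT) (F := zexp)).
set S := \sum_(_ | _) _.
have : S = z * S.
  rewrite {1}/S (reindex_inj (addrI 1)) /= big_distrr /=.
  by apply: eq_bigr => y _; rewrite zexpD (zexp_nat 1).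
move/eqP; rewrite -subr_eq0 -{1}[S]mul1r -mulrBl mulf_eq0 subr_eq0 => /orP[|/eqP //].
rewrite -(expr0 z) -{2}(expr1 z) (eq_prim_root_expr zP).
by rewrite mod0n modn_small // prime_gt1.
Qed.

(** The product of Gauss sums is grouped by the sum u of the two arguments. For u != 0 scaling by u
    gives the Jacobi sum; u = 0 contributes nothing because chi^(k+2) is nontrivial. *)
Lemma jacobi_gauss {k} : odd k -> jacobi k * gauss (k + 2) = gauss k * gauss 2.
Proof.
move=> k1; rewrite /gauss [RHS]big_distrl /=.
transitivity (\sum_x \sum_u psi k x * psi 2 (u - x) * zexp u); last first.
  apply: eq_bigr => x _; rewrite big_distrr (reindex_inj (addIr x)) /=.
  apply: eq_bigr => u _.
  by rewrite addrK zexpD; ring.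
rewrite exchange_big big_distrr /=; apply: eq_bigr => u _.
rewrite -big_distrl /= mulrA; congr (_ * _).
have [->|u0] := eqVneq u 0.
  rewrite psi0 mulr0; transitivity ((\sum_x psi (k + 2) x) * psi 2 (-1)).
    by rewrite sum_psi ?mul0r //; lia.
  rewrite big_distrl /=; apply: eq_bigr => x _.
  by rewrite -psiD sub0r -[- x]mulN1r psiM; ring.
rewrite /jacobi [RHS](reindex_inj (mulfI u0)) /= big_distrl /=; apply: eq_bigr => x _.
have -> : u - u * x = u * (1 - x) by ring.
by rewrite !psiM -psiD; ring.
Qed.

(** Replacing x by x y cancels the characters of y. The sum over y != 0 of the exponential of (x +
    1) y is p - 1 at x = -1 and -1 elsewhere, and the constant -1 is killed by the nontrivial
    character. *)
Lemma gauss_dual {j k} : (k %% 4 != 0)%N -> (j + k = 0 %[mod 4])%N ->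
  gauss j * gauss k = psi j (-1) * p%:R.
Proof.
move=> k0 jk; rewrite /gauss big_distrr /=.
transitivity (\sum_y \sum_x psi j x * (y != 0)%:R * zexp ((x + 1) * y)).
  apply: eq_bigr => y _; rewrite big_distrl /=.
  have [->|y0] := eqVneq y 0.
    by rewrite !big1 // => x _; rewrite ?psi0 ?mul0r ?mulr0 ?mul0r.
  rewrite (reindex_inj (mulIf y0)) /=; apply: eq_bigr => x _.
  rewrite mulrDl mul1r zexpD psiM.
  have -> : (true%:R = psi j y * psi k y) by rewrite psiD psi4 // y0.
  by ring.
rewrite exchange_big /=.
transitivity (\sum_x psi j x * ((if x + 1 == 0 then p%:R else 0) - 1)).
  apply: eq_bigr => x _; rewrite -sum_prim_root (bigD1 0) //= [in RHS](bigD1 0) //=.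
  rewrite !mulr0 (zexp_nat 0) expr0 mul0r add0r [1 + _]addrC addrK big_distrr /=.
  by apply: eq_bigr => y y0; rewrite y0 mulr1.
under eq_bigr do rewrite mulrBr mulr1.
rewrite big_split /= sumrN sum_psi ?oppr0 ?addr0; last by lia.
rewrite (bigD1 (-1)) //= addNr eqxx big1 ?addr0 // => x xN.
by rewrite addr_eq0 (negPf xN) mulr0.
Qed.

Context (Fp0 : p%:R != 0 :> F).

Lemma gauss2_sqr : gauss 2 ^+ 2 = p%:R.
Proof. by rewrite expr2 gauss_dual // psi2N1 mul1r. Qed.

Lemma gauss13 : gauss 1 * gauss 3 = psi 1 (-1) * p%:R.
Proof. by rewrite gauss_dual. Qed.

Lemma gauss5 : gauss 5 = gauss 1.
Proof. by apply: eq_bigr => x _; rewrite (@psi_mod 5 1). Qed.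

Lemma gauss13_neq0 : gauss 1 * gauss 3 != 0.
Proof. by rewrite gauss13 mulf_neq0 // psi_neq0 // oppr_eq0 oner_eq0. Qed.

Lemma jacobi_norm : jacobi 1 * jacobi 3 = p%:R.
Proof.
apply: (mulIf gauss13_neq0).
have E1 : jacobi 1 * gauss 3 = gauss 1 * gauss 2 by apply: (@jacobi_gauss 1).
have E3 : jacobi 3 * gauss 1 = gauss 3 * gauss 2.
  by rewrite -gauss5; apply: (@jacobi_gauss 3).
rewrite -gauss2_sqr.
transitivity ((jacobi 1 * gauss 3) * (jacobi 3 * gauss 1)); first by ring.
by rewrite E1 E3; ring.
Qed.

(** Taking the fourth power removes the p-th roots of unity, so powers of the Gauss sum can be
    compared with those of pi. *)
Lemma gauss1_expr4 : gauss 1 ^+ 4 = jacobi 1 ^+ 2 * p%:R.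
Proof.
apply: (mulIf Fp0).
have E1 : jacobi 1 * gauss 3 = gauss 1 * gauss 2 by apply: (@jacobi_gauss 1).
have E2 : jacobi 1 * (psi 1 (-1) * p%:R) = gauss 1 ^+ 2 * gauss 2.
  by rewrite -gauss13 mulrCA E1; ring.
rewrite -{1}gauss2_sqr.
transitivity ((gauss 1 ^+ 2 * gauss 2) ^+ 2); first by ring.
rewrite -E2; transitivity (psi 1 (-1) ^+ 2 * (jacobi 1 ^+ 2 * p%:R * p%:R)); first by ring.
by rewrite expr2 psiD psi2N1 mul1r.
Qed.

(** Frobenius turns chi(x) z^x into chi^g(x) z^(g x); the substitution of g x for x costs the factor
    chi^g(g). *)
Lemma gauss_Frobenius {g : nat} : g \in [pchar F] ->
  gauss 1 ^+ g * psi g g%:R = gauss g.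
Proof.
move=> gF.
have g0 : g%:R != 0 :> 'F_p.
  rewrite -(dvdn_pcharf (pchar_Fp p_pr)) dvdn_prime2 ?(pcharf_prime gF) //.
  by apply: contra_neq Fp0 => ->; rewrite pcharf0.
rewrite -(pFrobenius_autE gF) /gauss rmorph_sum /= big_distrl /=.
rewrite [RHS](reindex_inj (mulIf g0)) /=; apply: eq_bigr => x _.
rewrite pFrobenius_autE exprMn psiM mulrAC; congr (_ * _ * _).
  have [->|x0] := eqVneq x 0.
    by rewrite !psi0 expr0n; have := prime_gt1 (pcharf_prime gF); case: g {gF g0}.
  by rewrite !psiE // -exprM; congr (_ ^+ _); lia.
by rewrite {1}/zexp -exprM -zexp_nat natrM natr_Zp.
Qed.

End GaussSums.

End QuarticCharacter.

(** * The Jacobi sum J(chi, phi) as a primary Gaussian integer *)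

Lemma re4_mod {a b : nat} : a = b %[mod 4] -> re4 a = re4 b.
Proof. by rewrite /re4 => ->. Qed.

Lemma im4_mod {a b : nat} : a = b %[mod 4] -> im4 a = im4 b.
Proof. by rewrite /im4 => ->. Qed.

Section PrimaryPrime.

Context {p : nat} {h : 'F_p} (p_pr : prime p) (p4 : (p %% 4 = 1)%N)
  (hP : (p.-1).-primitive_root h).

(* With chi the quartic character sending h to i, the Gaussian integer
   jac_re + jac_im * i is -J(chi, phi). *)
Definition jac_re : int := - \sum_(x : 'F_p | x != 0) re4 (dlog h x) * phi (1 - x).
Definition jac_im : int := - \sum_(x : 'F_p | x != 0) im4 (dlog h x) * phi (1 - x).

Let p_odd : odd p. Proof. lia. Qed.
Let p1 : (1 < p)%N. Proof. exact: prime_gt1. Qed.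
Let p41 : (4 %| p.-1)%N. Proof. lia. Qed.

(** Multiplication by h^c permutes the nonzero elements and flips the sign of every term. This is
    the vanishing of nontrivial character sums in integer form. *)
Lemma sum_dlog (f : nat -> int) (c : nat) :
  (forall a b, a = b %[mod 4] -> f a = f b) ->
  (forall n, f (c + n)%N = - f n) -> \sum_(x : 'F_p | x != 0) f (dlog h x) = 0.
Proof.
move=> fmod fc; have h0 := prim_root_neq0 p_pr hP c.
have : \sum_(x : 'F_p | x != 0) f (dlog h x) = - \sum_(x : 'F_p | x != 0) f (dlog h x).
  rewrite {1}(reindex_inj (mulfI h0)) -sumrN.
  apply: eq_big => [x | x]; rewrite mulf_eq0 negb_or h0 //= => x0.
  rewrite -fc; apply: fmod.
  rewrite (eqmod_dvd p41 (dlogM p_pr hP _ _ h0 x0)).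
  by rewrite -modnDml (eqmod_dvd p41 (dlogX p_pr hP c)) modnDml.
by lia.
Qed.

Lemma phi_re4 (x : 'F_p) : x != 0 -> phi x = re4 (2 * dlog h x).
Proof.
move=> x0; rewrite /phi (negPf x0) (sqr_dlog p_pr hP p_odd) // /re4.
by case E : (odd _); rewrite (_ : (_ %% 4)%N = if odd (dlog h x) then 2 else 0)%N ?E //; lia.
Qed.

Lemma mod4_lt4 n : [\/ n = 0 %[mod 4], n = 1 %[mod 4], n = 2 %[mod 4] | n = 3 %[mod 4]].
Proof.
have : (n %% 4 < 4)%N by rewrite ltn_pmod.
by case: (n %% 4)%N => [|[|[|[|//]]]] _;
  [constructor 1|constructor 2|constructor 3|constructor 4].
Qed.

Lemma sum_re4 : \sum_(x : 'F_p | x != 0) re4 (dlog h x) = 0.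
Proof.
apply: (@sum_dlog re4 2) => [a b|n]; first exact: re4_mod.
by rewrite /re4 -modnDmr; case: (mod4_lt4 n) => ->.
Qed.

Lemma sum_im4 : \sum_(x : 'F_p | x != 0) im4 (dlog h x) = 0.
Proof.
apply: (@sum_dlog im4 2) => [a b|n]; first exact: im4_mod.
by rewrite /im4 -modnDmr; case: (mod4_lt4 n) => ->.
Qed.

Lemma sum_phi : \sum_(x : 'F_p) phi x = 0.
Proof.
rewrite (bigD1 0) //= {1}/phi eqxx add0r.
under eq_bigr => x x0 do rewrite phi_re4 //.
apply: (@sum_dlog (fun n => re4 (2 * n)) 1) => [a b E|n].
  by apply: re4_mod; rewrite -modnMmr E modnMmr.
have : ((2 * n) %% 4 = 0 /\ (2 * (1 + n)) %% 4 = 2 \/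
        (2 * n) %% 4 = 2 /\ (2 * (1 + n)) %% 4 = 0)%N by lia.
by rewrite /re4; case=> -[-> ->].
Qed.

Lemma phi1 : phi (1 : 'F_p) = 1.
Proof.
rewrite /phi oner_eq0; case: existsP => // -[]; exists 1.
by rewrite expr1n.
Qed.

Lemma phi_cases (x : 'F_p) : x != 0 -> phi x = 1 \/ phi x = -1.
Proof. by move=> x0; rewrite /phi (negPf x0); case: ifP; [left | right]. Qed.

Lemma sum_phi1 : \sum_(x : 'F_p | x != 0) phi (1 - x) = -1.
Proof.
have : \sum_(x : 'F_p) phi (1 - x) = 0.
  rewrite -[RHS]sum_phi [RHS](reindex_inj (inv_inj (subKr (1 : 'F_p)))) //.
by rewrite (bigD1 0) //= subr0 phi1 addrC => /eqP; rewrite addr_eq0 => /eqP.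
Qed.

Lemma dlog1 : dlog h 1 = 0 %[mod 4].
Proof. exact: (eqmod_dvd p41 (dlogX p_pr hP 0)). Qed.

Lemma dvdz_sum_nonzero (d : int) (f : 'F_p -> int) :
  (forall x, x != 0 -> (d %| f x)%Z) -> (d %| \sum_(x | x != 0%R) f x)%Z.
Proof. by move=> df; apply: rpred_sum => x /df. Qed.

(** As [im4] sums to 0, phi(1 - x) may be replaced by phi(1 - x) - 1, which is even except at x = 1,
    where [im4] vanishes. *)
Lemma jac_im_even : (2 %| jac_im)%Z.
Proof.
have -> : jac_im = - \sum_(x : 'F_p | x != 0) im4 (dlog h x) * (phi (1 - x) - 1).
  under [in RHS]eq_bigr do rewrite mulrBr mulr1.
  by rewrite big_split /= sumrN sum_im4 oppr0 addr0.
rewrite rpredN; apply: dvdz_sum_nonzero => x x0.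
have [->|x1] := eqVneq x 1; first by rewrite (im4_mod dlog1) mul0r.
have /phi_cases[] : 1 - x != 0 by rewrite subr_eq0 eq_sym.
all: by move=> ->; rewrite ?subrr ?mulr0 //; apply/dvdz_mull.
Qed.

(* Summing (chi(x) - 1)(phi(1 - x) - 1), whose terms are divisible by 2(1 - i),
   gives J = -1 modulo 2(1 - i). *)
Lemma jac_primary : (4 %| jac_re + jac_im - 1)%Z.
Proof.
have E : jac_re + jac_im - p%:Z =
    - \sum_(x : 'F_p | x != 0) (re4 (dlog h x) + im4 (dlog h x) - 1) * (phi (1 - x) - 1).
  transitivity (jac_re + jac_im + \sum_(x : 'F_p | x != 0) re4 (dlog h x)
     + \sum_(x : 'F_p | x != 0) im4 (dlog h x) + \sum_(x : 'F_p | x != 0) phi (1 - x)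
     - \sum_(x : 'F_p | x != 0) 1).
    rewrite sum_re4 sum_im4 sum_phi1 sumr_const.
    by rewrite (_ : #|_| = p.-1) ?cardC1 ?card_Fp //; lia.
  by rewrite /jac_re /jac_im -!sumrN -!big_split /=; apply: eq_bigr => x _; ring.
suff : (4 %| jac_re + jac_im - p%:Z)%Z by lia.
rewrite E rpredN; apply: dvdz_sum_nonzero => x x0.
have [->|x1] := eqVneq x 1.
  by rewrite (re4_mod dlog1) (im4_mod dlog1) subrr mul0r.
have /phi_cases[] : 1 - x != 0 by rewrite subr_eq0 eq_sym.
all: move=> ->; rewrite ?subrr ?mulr0 //.
by rewrite /re4 /im4; case: (mod4_lt4 (dlog h x)) => ->.
Qed.

Section Field.

Context {F : fieldType} {I : F} (I2 : I ^+ 2 = -1) (F2 : 2 != 0 :> F).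

Lemma jacobi_re_im :
  jacobi (h := h) (I := I) 1 = - (jac_re%:~R + jac_im%:~R * I).
Proof.
rewrite /jacobi (bigD1 0) //= psi0 mul0r add0r /jac_re /jac_im.
rewrite !rmorphN /= mulNr -opprD opprK !rmorph_sum /= big_distrl -big_split /=.
apply: eq_bigr => x x0; rewrite psiE // mul1n (sqrtN1_expr I2).
by rewrite -(phi_psi p_pr p4 hP I2) !rmorphM /=; ring.
Qed.

Lemma jacobi_conj_re_im :
  jacobi (h := h) (I := I) 3 = - (jac_re%:~R - jac_im%:~R * I).
Proof.
rewrite /jacobi (bigD1 0) //= psi0 mul0r add0r /jac_re /jac_im.
rewrite !rmorphN /= mulNr opprK opprD opprK !rmorph_sum /= big_distrl -sumrN -big_split /=.
apply: eq_bigr => x x0; rewrite psiE // -(phi_psi p_pr p4 hP I2) !rmorphM /=.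
suff -> : I ^+ (3 * dlog h x) = (re4 (dlog h x))%:~R - (im4 (dlog h x))%:~R * I by ring.
rewrite (sqrtN1_expr I2) /re4 /im4 -modnMmr.
by case: (mod4_lt4 (dlog h x)) => -> /=; rewrite ?mulrNz ?mulr0z ?mulr1z; ring.
Qed.

End Field.

(** An identity between integers, so it suffices to see it in [algC], where primitive p-th roots of
    unity provide the Gauss sums. *)
Lemma jac_norm : jac_re ^+ 2 + jac_im ^+ 2 = p%:Z.
Proof.
have i2 : 'i ^+ 2 = -1 :> algC by exact: sqrCi.
have n2 : 2 != 0 :> algC by rewrite pnatr_eq0.
have [z zP] := C_prim_root_exists (prime_gt0 p_pr).
have p0 : p%:R != 0 :> algC by rewrite pnatr_eq0; case: (p) p1.
have := jacobi_norm p_pr p4 hP i2 n2 zP p0.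
rewrite (jacobi_re_im i2) (jacobi_conj_re_im i2) => E.
apply: (@intr_inj algC); rewrite rmorphD !rmorphXn /= -[RHS]E.
by ring: i2.
Qed.

(** The two terms of [sum_cubic] are complex conjugates; the sum is -2 Re(conj(chi(D)) pi). *)
Lemma sum_cubic_re_im (D : 'F_p) : D != 0 ->
  \sum_x phi (x ^+ 3 - D * x)
    = - 2 * (re4 (dlog h D) * jac_re + im4 (dlog h D) * jac_im).
Proof.
move=> D0; have i2 : 'i ^+ 2 = -1 :> algC by exact: sqrCi.
have n2 : 2 != 0 :> algC by rewrite pnatr_eq0.
have := sum_cubic p_pr p4 hP i2 n2 D D0.
under eq_bigr do rewrite -(phi_psi p_pr p4 hP i2).
rewrite -rmorph_sum /= (jacobi_re_im i2) (jacobi_conj_re_im i2) => E.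
apply: (@intr_inj algC); rewrite E !psiE //.
rewrite mul1n (sqrtN1_expr i2 (dlog h D)) (sqrtN1_expr i2 (3 * _)).
have -> : re4 (3 * dlog h D) = re4 (dlog h D).
  by rewrite /re4 -modnMmr; case: (mod4_lt4 (dlog h D)) => -> /=.
have -> : im4 (3 * dlog h D) = - im4 (dlog h D).
  by rewrite /im4 -modnMmr; case: (mod4_lt4 (dlog h D)) => -> /=.
by rewrite !(rmorphM, rmorphD, rmorphN) /=; ring: i2.
Qed.

End PrimaryPrime.

(** * Rational quartic reciprocity *)

(* (g - (-1/g)) / 4 for g odd: both (g - 1) / 4 for g = 1 mod 4 and (g + 1) / 4
   for g = 3 mod 4 are the integral part of (g + 1) / 4. *)
Definition quarter (g : nat) : nat := ((g + 1) %/ 4)%N.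

Lemma odd_mod4_neq1 {g : nat} : odd g -> (g %% 4 <> 1)%N -> (g %% 4 = 3)%N.
Proof. lia. Qed.

Lemma quarter_mod1 {g : nat} : (g %% 4 = 1)%N -> g = (4 * quarter g + 1)%N.
Proof. by rewrite /quarter; lia. Qed.

Lemma quarter_mod3 {g : nat} : (g %% 4 = 3)%N -> (4 * quarter g = g + 1)%N.
Proof. by rewrite /quarter; lia. Qed.

(* For a, b in F_g with a^2 + b^2 != 0 this is a fourth root of unity; it plays the
   role of the quartic residue symbol of a + b i modulo g. *)
Definition qratio {F : fieldType} (I : F) (g : nat) (a b : F) : F :=
  ((a + b * I) / (a - b * I)) ^+ quarter g.

Section Reciprocity.

Context {F : fieldType} {I : F} (I2 : I ^+ 2 = -1).

Section Qratio.

Context (g : nat) (a b : F).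

Lemma qratioNr : qratio I g a (- b) = (qratio I g a b)^-1.
Proof. by rewrite /qratio -exprVn invf_div mulNr opprK. Qed.

Lemma qratioNl : qratio I g (- a) b = (qratio I g a b)^-1.
Proof.
rewrite -qratioNr /qratio; congr (_ ^+ _).
have -> : - a + b * I = - (a + - b * I) by ring.
have -> : - a - b * I = - (a - - b * I) by ring.
by rewrite invrN mulrNN.
Qed.

(** Exchanging a and b is conjugation followed by multiplication by I, and I / (-I) = -1. *)
Lemma qratioC : qratio I g b a = (-1) ^+ quarter g / qratio I g a b.
Proof.
rewrite -qratioNr /qratio -exprMn; congr (_ ^+ _).
have -> : b + a * I = I * (a + - b * I) by ring: I2.
have -> : b - a * I = - I * (a - - b * I) by ring: I2.
rewrite invfM mulrACA; congr (_ * _).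
by rewrite invrN mulrN divff // (sqrtN1_neq0 I2).
Qed.

End Qratio.

Context {g : nat} (gF : g \in [pchar F]) (g_odd : odd g).

Let g1 : (1 < g)%N. Proof. exact: prime_gt1 (pcharf_prime gF). Qed.

Lemma pchar_odd_neq2 : 2 != 0 :> F.
Proof.
rewrite -(dvdn_pcharf gF); apply/negP => /(dvdn_leq (isT : 0 < 2)%N).
by move: g_odd g1; case: (g) => [|[|[|]]].
Qed.

Lemma sqrtN1_expr_pchar : I ^+ g = if (g %% 4 == 1)%N then I else - I.
Proof.
case: ifP => /eqP g4; first by rewrite (@sqrtN1_mod _ _ I2 g 1).
have g3 : g = 3 %[mod 4] by lia.
by rewrite (sqrtN1_mod I2 g3); ring: I2.
Qed.

Lemma Gauss_int_Frobenius (a b : int) :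
  (a%:~R + b%:~R * I) ^+ g
    = a%:~R + b%:~R * (if (g %% 4 == 1)%N then I else - I).
Proof.
rewrite -(pFrobenius_autE gF) rmorphD rmorphM /= !pFrobenius_autE.
by rewrite sqrtN1_expr_pchar -!(pFrobenius_autE gF) !rmorph_int.
Qed.

Context {p : nat} {h : 'F_p} (p_pr : prime p) (p4 : (p %% 4 = 1)%N)
  (hP : (p.-1).-primitive_root h) (pg : p != g)
  {z : F} (zP : p.-primitive_root z).

(** With u = pi, v its conjugate and q = [quarter g], the relations u v = p and G(chi)^4 = u^2 p =
    u^4 / (u/v) give G(chi)^(4q) = u^(4q) / (u/v)^q. By Frobenius u^(4q) is u^(g-1) = 1 if g = 1 mod
    4, and u^(g+1) = u v = p if g = 3 mod 4. Comparison with [gauss_Frobenius] isolates (u/v)^q; in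
    the second case the extra factor G(chi) brings in G(chi) G(chi^3) = chi(-1) p, hence the
    sign. *)
Lemma quartic_reciprocity :
  qratio I g (jac_re (h := h))%:~R (jac_im (h := h))%:~R =
    if (g %% 4 == 1)%N then I ^+ dlog h g%:R
    else I ^+ (3 * dlog h g%:R) * (-1) ^+ (p.-1 %/ 4).
Proof.
have F2 := pchar_odd_neq2.
have p0 : p%:R != 0 :> F.
  rewrite -(dvdn_pcharf gF) dvdn_prime2 ?(pcharf_prime gF) //.
  by rewrite eq_sym.
have g0 : g%:R != 0 :> 'F_p.
  by rewrite -(dvdn_pcharf (pchar_Fp p_pr)) dvdn_prime2 ?(pcharf_prime gF).
have JJ := jacobi_norm p_pr p4 hP I2 F2 zP p0.
have G4 := gauss1_expr4 p_pr p4 hP I2 F2 zP p0.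
have G13 := gauss13 p_pr p4 hP I2 F2 zP.
have GF := gauss_Frobenius p_pr p4 hP I2 F2 zP p0 gF.
have G0 := gauss13_neq0 p_pr p4 hP I2 F2 zP p0.
have A0 := Gauss_int_Frobenius (jac_re (h := h)) (jac_im (h := h)).
rewrite psiE // in GF.
move: JJ G4; rewrite (jacobi_re_im p_pr p4 hP I2) (jacobi_conj_re_im p_pr p4 hP I2).
rewrite /qratio; set u := _ + _ * I; set v := _ - _ * I.
rewrite mulrNN sqrrN => JJ G4.
have [u0 v0] : u != 0 /\ v != 0.
  by apply/andP; rewrite -negb_or -mulf_eq0 JJ.
have [t0 t0'] : gauss (h := h) (I := I) (z := z) 1 != 0 /\ gauss (h := h) (I := I) (z := z) 3 != 0.
  by apply/andP; rewrite -negb_or -mulf_eq0.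
have key : u ^+ 2 * p%:R = u ^+ 4 / (u / v).
  by rewrite -JJ; field; rewrite u0 v0.
have uv0 : (u / v) ^+ quarter g != 0 by rewrite expf_neq0 // mulf_neq0 ?invr_eq0.
apply: (mulIf (invr_neq0 uv0)); rewrite divff //.
case: ifP => /eqP g4.
  have E := quarter_mod1 g4.
  have u4 : (u ^+ 4) ^+ quarter g = 1.
    apply: (mulIf u0); rewrite mul1r -exprM -exprSr -addn1 -E A0.
    by rewrite g4 eqxx.
  have := GF; rewrite {1}E exprD exprM G4 key expr1 exprMn u4 mul1r.
  rewrite exprVn {2}E mulnDl -mulnA exprD exprM (sqrtN1_expr4 I2) expr1n mul1r mul1n.
  have -> : gauss (h := h) (I := I) (z := z) g = gauss (h := h) (I := I) (z := z) 1.
    by apply: eq_bigr => x _; rewrite (@psi_mod _ _ _ _ I2 g 1).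
  rewrite mulrAC -[RHS]mul1r => /(mulIf t0) <-.
  by rewrite mulrC.
have g3 : (g %% 4 = 3)%N by apply: odd_mod4_neq1.
have E' := quarter_mod3 g3.
have u4 : (u ^+ 4) ^+ quarter g = p%:R.
  rewrite -exprM E' addn1 exprSr A0 ifN; last by apply/eqP.
  by rewrite mulrN mulrC JJ.
have GG : gauss (h := h) (I := I) (z := z) g = gauss (h := h) (I := I) (z := z) 3.
  by apply: eq_bigr => x _; rewrite (@psi_mod _ _ _ _ I2 g 3).
have := congr1 (fun x => gauss (h := h) (I := I) (z := z) 1 * x) GF.
rewrite GG G13 mulrA -exprS -[g.+1]addn1 -E' exprM G4 key exprMn u4 exprVn.
rewrite -mulrA [RHS]mulrC => /(mulfI p0).
rewrite (psi1N1 p_pr p4 hP I2 F2).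
have -> : I ^+ (g * dlog h g%:R) = I ^+ (3 * dlog h g%:R).
  by apply: (sqrtN1_mod I2); rewrite -modnMml g3.
move=> E2; rewrite mulrAC [I ^+ _ * _]mulrC E2.
by rewrite -exprD -signr_odd addnn odd_double.
Qed.

End Reciprocity.

(** * Sums of two squares and the criterion for the trace *)

Lemma Euclid_dvdzM {p : nat} (a b : int) : prime p ->
  (p%:Z %| a * b)%Z = (p%:Z %| a)%Z || (p%:Z %| b)%Z.
Proof. by move=> p_pr; rewrite !dvdzE abszM Euclid_dvdM. Qed.

(** The prime p divides A^2 m^2 - B^2 s^2 = p (A^2 - s^2), hence A m - b s for b = B or b = -B.
    Since (A s + b m)^2 + (A m - b s)^2 = p^2, one of the two squares is 0, which gives A^2 = m^2 or
    A^2 = s^2. *)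
Lemma two_squares_unique {p : nat} (A B s m : int) : prime p ->
  A ^+ 2 + B ^+ 2 = p%:Z -> s ^+ 2 + m ^+ 2 = p%:Z ->
  (A = s \/ A = - s) /\ (B = m \/ B = - m) \/
  (A = m \/ A = - m) /\ (B = s \/ B = - s).
Proof.
move=> p_pr AB sm; have p0 : p%:Z != 0 by case: p p_pr {AB sm}.
have sqrE (x y : int) : x ^+ 2 = y ^+ 2 -> x = y \/ x = - y.
  by move/eqP; rewrite eqf_sqr => /orP[] /eqP; [left | right].
suff : A ^+ 2 = s ^+ 2 \/ A ^+ 2 = m ^+ 2.
  case=> E; [left | right]; split; apply: sqrE => //; lia.
have key (b : int) : b ^+ 2 = B ^+ 2 -> (p%:Z %| A * m - b * s)%Z ->
    A ^+ 2 = s ^+ 2 \/ A ^+ 2 = m ^+ 2.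
  move=> bB /dvdzP[k Ek].
  have E1 : (A * s + b * m) ^+ 2 + (A * m - b * s) ^+ 2 = p%:Z ^+ 2.
    transitivity ((A ^+ 2 + B ^+ 2) * (s ^+ 2 + m ^+ 2)); last by rewrite AB sm expr2.
    by rewrite -bB; ring.
  have E2 : (A * m - b * s) * (A * m + b * s) = p%:Z * (A ^+ 2 - s ^+ 2).
    have -> : p%:Z * (A ^+ 2 - s ^+ 2) = A ^+ 2 * p%:Z - p%:Z * s ^+ 2 by ring.
    by rewrite -{1}sm -AB -bB; ring.
  have [k0 | k0] := eqVneq k 0.
    left; apply/eqP; rewrite -subr_eq0 -(mulrI_eq0 _ (mulfI p0)) -E2 Ek k0.
    by rewrite !mul0r.
  have E3 : A * s + b * m = 0.
    have k1 : p%:Z ^+ 2 <= (k * p%:Z) ^+ 2.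
      rewrite exprMn ler_peMl ?sqr_ge0 //.
      by have : 0 < k ^+ 2; [rewrite exprn_even_gt0 | lia].
    apply/eqP; rewrite -sqrf_eq0 eq_le sqr_ge0 andbT.
    by rewrite -(addrK ((A * m - b * s) ^+ 2) (_ ^+ 2)) E1 Ek subr_le0.
  right; apply: (mulfI p0).
  have : (A * s) ^+ 2 = (b * m) ^+ 2 by rewrite -(addr0_eq E3) sqrrN.
  rewrite !exprMn bB (_ : B ^+ 2 = p%:Z - A ^+ 2); last by rewrite -AB addrC addKr.
  rewrite (_ : s ^+ 2 = p%:Z - m ^+ 2); last by rewrite -sm addrK.
  move=> /eqP; rewrite -subr_eq0 => /eqP E.
  by apply/eqP; rewrite -subr_eq0 -E; apply/eqP; ring.
have : (p%:Z %| (A * m - B * s) * (A * m + B * s))%Z.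
  apply/dvdzP; exists (A ^+ 2 - s ^+ 2).
  transitivity (A ^+ 2 * (s ^+ 2 + m ^+ 2) - (A ^+ 2 + B ^+ 2) * s ^+ 2); first by ring.
  by rewrite AB sm; ring.
rewrite Euclid_dvdzM // => /orP[] pd.
  exact: (key B).
by apply: (key (- B)); rewrite ?sqrrN // mulNr opprK.
Qed.

Section SqrtN1Exprz.

Context {F : fieldType} {I : F} (I2 : I ^+ 2 = -1) (F2 : 2 != 0 :> F).

Lemma sqrtN1_exprz_eq (a b : int) : I ^ a = I ^ b <-> (4 %| a - b)%Z.
Proof.
have I0 := sqrtN1_neq0 I2.
have I4 : I ^ 4%:Z = 1 by rewrite -exprnP (sqrtN1_expr4 I2).
have mod4 (c : int) : I ^ c = I ^+ `|(c %% 4)%Z|.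
  rewrite [in LHS](divz_eq c 4) expfzDr // [(c %/ 4)%Z * 4]mulrC -exprz_exp I4 exp1rz mul1r exprnP.
  by rewrite gez0_abs // modz_ge0.
split=> [E | /dvdzP[k E]]; last first.
  by rewrite -(subrK b a) E expfzDr // [k * 4]mulrC -exprz_exp I4 exp1rz mul1r.
have : I ^ (a - b) = 1 by rewrite expfzDr // E -expfzDr // subrr expr0z.
rewrite mod4 => E1.
have lt4 : (`|((a - b) %% 4)%Z| < 4)%N by lia.
apply: contraTT isT => ab; suff : I ^+ `|((a - b) %% 4)%Z| != 1 by rewrite E1 eqxx.
by apply: (sqrtN1_neq1 I2 F2); lia.
Qed.

End SqrtN1Exprz.

(* The prime p = s^2 + m^2 has trace 2 s at y^2 = x^3 - g x exactly when
   ((s + i m) / (s - i m))^(n/4) = i^(quartic_exp g s m) in characteristic g. *)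
Definition quartic_exp (g : nat) (s m : int) : int :=
  if (2 %| s)%Z then
    (if (g %% 4 == 1)%N then s - m else m) + 2 * (quarter g)%:Z
  else if (g %% 4 == 1)%N then s + m - 1 else s - 1.

Lemma quartic_exp_mod4 (g : nat) (s m m' : int) :
  (4 %| m - m')%Z -> (4 %| quartic_exp g s m - quartic_exp g s m')%Z.
Proof. by rewrite /quartic_exp; case: ifP => _; case: ifP => _; lia. Qed.

Lemma odd_sqr_mod8 (s : int) : ~~ (2 %| s)%Z -> (8 %| s ^+ 2 - 1)%Z.
Proof.
move=> s1; have [k ->] : exists k, s = 2 * k + 1 by exists (s %/ 2)%Z; lia.
have -> : (2 * k + 1) ^+ 2 - 1 = 4 * (k * (k + 1)) by ring.
have : (2 %| k * (k + 1))%Z.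
  have [k2|k2] : (2 %| k)%Z \/ (2 %| k + 1)%Z by lia.
    exact: dvdz_mulr.
  exact: dvdz_mull.
by lia.
Qed.

(** The residue 2 s covers both classes of even s mod 4 in a linear form that [lia] can use. *)
Lemma even_sqr_mod8 (s : int) : (2 %| s)%Z -> (8 %| s ^+ 2 - 2 * s)%Z.
Proof.
move=> s1; have [k ->] : exists k, s = 2 * k by exists (s %/ 2)%Z; lia.
have -> : (2 * k) ^+ 2 - 2 * (2 * k) = 4 * (k * (k - 1)) by ring.
have : (2 %| k * (k - 1))%Z.
  have [k2|k2] : (2 %| k)%Z \/ (2 %| k - 1)%Z by lia.
    exact: dvdz_mulr.
  exact: dvdz_mull.
by lia.
Qed.

(** P = (p - 1)/4 enters reciprocity through chi(-1) = (-1)^P. Modulo 8 the odd square is 1 and the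
    even one is twice its root, so the even root is 2 P mod 4. *)
Lemma two_squares_parity {P s m : int} : s ^+ 2 + m ^+ 2 = 4 * P + 1 ->
  if (2 %| s)%Z then ~~ (2 %| m)%Z /\ (4 %| 2 * P - s)%Z
  else (2 %| m)%Z /\ (4 %| 2 * P - m)%Z.
Proof.
have [s2|s2] := boolP (2 %| s)%Z; have [m2|m2] := boolP (2 %| m)%Z.
- by have := even_sqr_mod8 _ s2; have := even_sqr_mod8 _ m2; lia.
- by have := even_sqr_mod8 _ s2; have := odd_sqr_mod8 _ m2; lia.
- by have := odd_sqr_mod8 _ s2; have := even_sqr_mod8 _ m2; lia.
- by have := odd_sqr_mod8 _ s2; have := odd_sqr_mod8 _ m2; lia.
Qed.

(** t = Re(i^(-l) (A + B i)), as a disjunction of linear cases. *)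
Definition re_rot (l : nat) (A B t : int) : Prop :=
  [\/ (l %% 4 = 0)%N /\ t = A, (l %% 4 = 1)%N /\ t = B,
      (l %% 4 = 2)%N /\ t = - A | (l %% 4 = 3)%N /\ t = - B].

Lemma re_rotP (l : nat) (A B : int) : re_rot l A B (re4 l * A + im4 l * B).
Proof.
rewrite /re_rot /re4 /im4.
by case: (mod4_lt4 l) => -> /=; [constructor 1 | constructor 2 | constructor 3 | constructor 4];
  split=> //; ring.
Qed.

Lemma mod4_1E {p : nat} : (p %% 4 = 1)%N -> p%:Z = 4 * (p.-1 %/ 4)%N%:Z + 1.
Proof. lia. Qed.

(** The exponent of i on the right of [quartic_reciprocity]: b says whether g = 1 mod 4, and (-1)^P
    is i^(2P). *)
Definition reciprocity_exp (b : bool) (l : nat) (P : int) : int :=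
  if b then l%:Z else 3 * l%:Z + 2 * P.

(** An odd l would make t = m or t = -m, which is even. So t = s means l = 0 or 2 mod 4 according to
    the sign of A = ±s, and the primary congruence reads this sign off s + m mod 4. Unequal signs of
    A and B invert the ratio, hence -e. *)
Lemma exp_odd {s m P A B t : int} {l : nat} {b : bool} (cA cB : bool) :
  s ^+ 2 + m ^+ 2 = 4 * P + 1 -> (4 %| A + B - 1)%Z -> re_rot l A B t ->
  ~~ (2 %| s)%Z ->
  A = (if cA then s else - s) -> B = (if cB then m else - m) ->
  let e := reciprocity_exp b l P in
  t = s <-> (4 %| (if cA == cB then e else - e) - (if b then s + m - 1 else s - 1))%Z.
Proof.
move=> sm AB1 tE s2; have := two_squares_parity sm; rewrite (negPf s2) => -[m2 P4].
move: AB1 tE; rewrite /reciprocity_exp /re_rot {sm}.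
by case: cA; case: cB; case: b => AB1 tE EA EB /=; subst A B; case: tE => -[]; lia.
Qed.

(** Now B = ±s is the even part, so t = s means l = 1 or 3 mod 4; as s != 0 these exclude each
    other. The terms 2 q come from the factor (-1)^q of the exchange of s and m. *)
Lemma exp_even {s m P A B t : int} {l : nat} {b : bool} (q : int) (cA cB : bool) :
  s != 0 -> s ^+ 2 + m ^+ 2 = 4 * P + 1 -> (4 %| A + B - 1)%Z -> re_rot l A B t ->
  (2 %| s)%Z ->
  A = (if cA then m else - m) -> B = (if cB then s else - s) ->
  let e := reciprocity_exp b l P in
  t = s <-> (4 %| (if cA == cB then 2 * q - e else e - 2 * q)
    - ((if b then s - m else m) + 2 * q))%Z.
Proof.
move=> s0 sm AB1 tE s2; have := two_squares_parity sm; rewrite s2 => -[m2 P4].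
move: AB1 tE; rewrite /reciprocity_exp /re_rot {sm}.
by case: cA; case: cB; case: b => AB1 tE EA EB /=; subst A B; case: tE => -[]; lia.
Qed.

Lemma trace_sum_two_squares {p : nat} {D : 'F_p} {s : int} :
  prime p -> (p %% 4 = 1)%N -> D != 0 ->
  \sum_(x : 'F_p) phi (x ^+ 3 - D * x) = - 2 * s ->
  exists m : int, s ^+ 2 + m ^+ 2 = p%:Z.
Proof.
move=> p_pr p4 D0; have [h hP] := Fp_prim_root p_pr.
rewrite (sum_cubic_re_im p_pr p4 hP) //.
have := jac_norm p_pr p4 hP; move: (jac_re) (jac_im) (dlog h D) => A B l AB E.
have {E} -> : s = re4 l * A + im4 l * B by lia.
case: (re_rotP l A B) => -[_ ->]; [exists B|exists A|exists B|exists A].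
all: by rewrite -AB; ring.
Qed.

Section TraceCriterion.

Context {F : fieldType} {I : F} (I2 : I ^+ 2 = -1).
Context {g : nat} (gF : g \in [pchar F]) (g_odd : odd g).
Context {p : nat} (p_pr : prime p) (p4 : (p %% 4 = 1)%N) (pg : p != g)
  {z : F} (zP : p.-primitive_root z).

Lemma qratio_exprz (a b : int) (e : int) :
  qratio I g a%:~R b%:~R = I ^ e ->
  [/\ qratio I g a%:~R (- b)%:~R = I ^ (- e),
      qratio I g (- a)%:~R b%:~R = I ^ (- e),
      qratio I g (- a)%:~R (- b)%:~R = I ^ e,
      qratio I g b%:~R a%:~R = I ^ (2 * (quarter g)%:Z - e) &
      [/\ qratio I g b%:~R (- a)%:~R = I ^ (e - 2 * (quarter g)%:Z),
      qratio I g (- b)%:~R a%:~R = I ^ (e - 2 * (quarter g)%:Z) &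
      qratio I g (- b)%:~R (- a)%:~R = I ^ (2 * (quarter g)%:Z - e)]].
Proof.
move=> E; have I0 := sqrtN1_neq0 I2.
have C : qratio I g b%:~R a%:~R = I ^ (2 * (quarter g)%:Z - e).
  have I2z : I ^ (2 : int) = -1 by rewrite -exprnP.
  by rewrite (qratioC I2) E invr_expz expfzDr // -exprz_exp I2z -exprnP.
by rewrite !rmorphN /= !(qratioNr, qratioNl) C E !invr_expz !(opprB, opprK).
Qed.

(** By uniqueness pi is one of ±s ± m i, ±m ± s i. Its reciprocity value is transported to s + m i
    by [qratio_exprz]; the logarithm of g, the only trace of the choice of h, then occurs in both
    conditions and cancels. *)
Lemma trace_criterion (s m : int) : s != 0 -> s ^+ 2 + m ^+ 2 = p%:Z ->
  \sum_(x : 'F_p) phi (x ^+ 3 - g%:R * x) = - 2 * s <->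
  qratio I g s%:~R m%:~R = I ^ quartic_exp g s m.
Proof.
move=> s0 sm; have [h hP] := Fp_prim_root p_pr.
have g0 : g%:R != 0 :> 'F_p.
  by rewrite -(dvdn_pcharf (pchar_Fp p_pr)) dvdn_prime2 ?(pcharf_prime gF).
have F2 := pchar_odd_neq2 gF g_odd.
rewrite (sum_cubic_re_im p_pr p4 hP) //.
have := quartic_reciprocity I2 gF g_odd p_pr p4 hP pg zP.
have := jac_norm p_pr p4 hP.
have := jac_im_even p_pr p4 hP.
have := jac_primary p_pr p4 hP.
move: (jac_re) (jac_im) (dlog h g%:R) => A B l AB1 B2 AB R.
have {R} R : qratio I g A%:~R B%:~R =
    I ^ (if (g %% 4 == 1)%N then l%:Z else 3 * l%:Z + 2 * ((p.-1 %/ 4)%N : nat)%:Z).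
  rewrite R; case: ifP => _ //.
  have I2z : I ^ (2 : int) = -1 by rewrite -exprnP.
  by rewrite expfzDr ?(sqrtN1_neq0 I2) // -[in RHS](exprz_exp I 2) I2z -!exprnP.
have [R1 R2 R3 R4 [R5 R6 R7]] := qratio_exprz _ _ _ R.
have smP : s ^+ 2 + m ^+ 2 = 4 * (p.-1 %/ 4)%N%:Z + 1.
  by rewrite sm (mod4_1E p4).
have tE := re_rotP l A B; move: (re4 l * A + im4 l * B) tE => t tE.
suff [e [-> tsE]] : exists e, qratio I g s%:~R m%:~R = I ^ e /\
    (t = s <-> (4 %| e - quartic_exp g s m)%Z).
  rewrite (sqrtN1_exprz_eq I2 F2) -tsE.
  by split=> [/(mulfI (isT : - 2 != 0 :> int)) | ->].
(* B is even, so the parity of s decides which of s and m it matches. *)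
have [[As Bm]|[Am Bs]] := two_squares_unique A B s m p_pr AB sm.
- have m2 : (2 %| m)%Z by case: Bm B2 => ->; rewrite ?rpredN.
  have s2 : ~~ (2 %| s)%Z.
    by have := two_squares_parity smP; case: ifP => // _ []; rewrite m2.
  rewrite /quartic_exp (negPf s2).
  case: As => As; case: Bm => Bm; rewrite As Bm ?opprK in R R1 R2 R3; eexists; split.
  + exact: R.
  + exact: (exp_odd true true smP AB1 tE s2 As Bm).
  + exact: R1.
  + exact: (exp_odd true false smP AB1 tE s2 As Bm).
  + exact: R2.
  + exact: (exp_odd false true smP AB1 tE s2 As Bm).
  + exact: R3.
  + exact: (exp_odd false false smP AB1 tE s2 As Bm).
- have s2 : (2 %| s)%Z by case: Bs B2 => ->; rewrite ?rpredN.
  rewrite /quartic_exp s2.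
  case: Am => Am; case: Bs => Bs; rewrite Am Bs ?opprK in R4 R5 R6 R7; eexists; split.
  + exact: R4.
  + exact: (exp_even _ true true s0 smP AB1 tE s2 Am Bs).
  + exact: R6.
  + exact: (exp_even _ true false s0 smP AB1 tE s2 Am Bs).
  + exact: R5.
  + exact: (exp_even _ false true s0 smP AB1 tE s2 Am Bs).
  + exact: R7.
  + exact: (exp_even _ false false s0 smP AB1 tE s2 Am Bs).
Qed.

End TraceCriterion.

(** * Counting the values of the residue symbol *)

Lemma unity_roots_uniq {K : closedFieldType} {n : nat} : n%:R != 0 :> K ->
  exists rs : seq K, [/\ uniq rs, size rs = n & forall x, (x \in rs) = (x ^+ n == 1)].
Proof.
move=> n0; have n_gt0 : (0 < n)%N by case: n n0; rewrite ?eqxx.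
have [rs E] := closed_field_poly_normal ('X^n - 1 : {poly K}).
rewrite lead_coefXnsubC // scale1r in E.
exists rs; split=> [||x].
- by rewrite -separable_prod_XsubC -E separable_Xn_sub_1.
- by apply/eqP; rewrite -eqSS -(size_prod_XsubC rs id) -E size_XnsubC.
- by rewrite -root_prod_XsubC -E rootE !hornerE subr_eq0.
Qed.

Lemma power_roots_uniq {K : closedFieldType} {n : nat} {z : K} : n%:R != 0 :> K ->
  z != 0 ->
  exists rs : seq K, [/\ uniq rs, size rs = n & forall x, (x \in rs) = (x ^+ n == z)].
Proof.
move=> n0 z0; have n_gt0 : (0 < n)%N by case: n n0; rewrite ?eqxx.
have [rs [rs_uniq rs_size rsE]] := unity_roots_uniq n0.
have [w wn] : exists w, w ^+ n = z.
  have /closed_rootP[w] : size ('X^n - z%:P : {poly K}) != 1%N.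
    by rewrite size_XnsubC //; lia.
  by rewrite rootE !hornerE subr_eq0 => /eqP; exists w.
have w0 : w != 0.
  by apply: contra_neq z0 => w0; rewrite -wn w0 expr0n; case: (n) n_gt0.
exists [seq w * x | x <- rs]; split=> [||x].
- by rewrite map_inj_uniq //; apply: mulfI.
- by rewrite size_map.
- rewrite -{1}[x](mulVKf w0) (mem_map (mulfI w0)) rsE exprMn exprVn wn.
  by rewrite -(inj_eq (mulfI z0)) mulr1 mulVKf.
Qed.

Lemma closed_prim_root {K : closedFieldType} {p : nat} : prime p -> p%:R != 0 :> K ->
  exists z : K, p.-primitive_root z.
Proof.
move=> p_pr p0; have [rs [rs_uniq rs_size rsE]] := unity_roots_uniq p0.
have /hasP[z _ zP] : has p.-primitive_root rs.
  apply: cyclic.has_prim_root; rewrite ?prime_gt0 ?rs_size //.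
  by apply/allP => x; rewrite rsE unity_rootE.
by exists z.
Qed.

Lemma closed_sqrtN1 {K : closedFieldType} : exists I : K, I ^+ 2 = -1.
Proof.
have /closed_rootP[w] : size ('X^2 - (-1)%:P : {poly K}) != 1%N by rewrite size_XnsubC.
by rewrite rootE !hornerE subr_eq0 => /eqP; exists w.
Qed.

Lemma Fp_embedding_image {K : fieldType} {g : nat} (g_pr : prime g)
  (f : {rmorphism 'F_g -> K}) (x : K) : x ^+ g = x -> exists u, f u = x.
Proof.
move=> xg; have g1 := prime_gt1 g_pr.
have [/mapP[u _ ->]|xn] := boolP (x \in [seq f u | u <- enum 'F_g]); first by exists u.
have X0 : size ('X^g - 'X : {poly K}) = g.+1.
  by rewrite size_polyDl size_polyXn // size_polyN size_polyX ltnS.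
suff : (size (x :: [seq f u | u <- enum 'F_g]) < g.+1)%N.
  by rewrite /= size_map -cardE card_Fp // ltnn.
rewrite -X0; apply: max_poly_roots.
- by rewrite -size_poly_eq0 X0.
- apply/allP => y; rewrite inE => /orP[/eqP -> | /mapP[u _ ->]].
    by rewrite rootE !hornerE xg subrr.
  rewrite rootE !hornerE -rmorphXn -[X in u ^+ X](card_Fp g_pr) expf_card.
  by rewrite subrr.
- by rewrite cons_uniq xn map_inj_uniq ?enum_uniq //; apply: fmorph_inj.
Qed.

Section QratioCount.

Context {K : closedFieldType} {I : K} (I2 : I ^+ 2 = -1).
Context {g : nat} (g_pr : prime g) (g_odd : odd g) (f : {rmorphism 'F_g -> K}).

Lemma pchar_Fp_embedding : g \in [pchar K].
Proof. exact: (rmorph_pchar f (pchar_Fp g_pr)). Qed.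

(* u |-> (s + u I) / (s - u I) is a bijection from the u with s^2 + u^2 != 0
   onto the roots of unity of order dividing g - (-1/g), except -1. *)
Lemma card_qratio (s : 'F_g) (z : K) : s != 0 -> z ^+ 4 = 1 ->
  #|[set u : 'F_g | (s ^+ 2 + u ^+ 2 != 0) && (qratio I g (f s) (f u) == z)]|
    = (quarter g - ((-1) ^+ quarter g == z))%N.
Proof.
move=> s0 z4; have g1 := prime_gt1 g_pr; have gK := pchar_Fp_embedding.
have K2 := pchar_odd_neq2 gK g_odd.
have I0 := sqrtN1_neq0 I2.
have z0 : z != 0.
  by apply: contra_eq_neq z4 => ->; rewrite expr0n eq_sym oner_eq0.
have a0 : f s != 0 by rewrite fmorph_eq0.
have q0 : (quarter g)%:R != 0 :> K.
  rewrite -(dvdn_pcharf gK); apply/negP => /dvdn_leq.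
  by rewrite /quarter; lia.
have [rs [rs_uniq rs_size rsE]] := power_roots_uniq q0 z0.
set S := [set _ | _].
pose w (u : 'F_g) := (f s + f u * I) / (f s - f u * I).
have normE u : (f s + f u * I) * (f s - f u * I) = f (s ^+ 2 + u ^+ 2).
  by rewrite rmorphD !rmorphXn /=; ring: I2.
have norm0 u : s ^+ 2 + u ^+ 2 != 0 -> (f s + f u * I != 0) /\ (f s - f u * I != 0).
  by move=> su; apply/andP; rewrite -negb_or -mulf_eq0 normE fmorph_eq0.
have -> : #|S| = size [seq x <- rs | x != -1].
  rewrite cardE -(size_map w); apply/perm_size/uniq_perm.
  - rewrite map_inj_in_uniq ?enum_uniq // => u v.
    rewrite !mem_enum !inE => /andP[/norm0[u1 u2] _] /andP[/norm0[v1 v2] _].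
    move/eqP; rewrite /w eqr_div // -subr_eq0.
    have -> : (f s + f u * I) * (f s - f v * I) - (f s + f v * I) * (f s - f u * I)
       = 2 * f s * I * (f u - f v) by ring.
    rewrite !mulf_eq0 (negPf K2) (negPf a0) (negPf I0) /= subr_eq0 => /eqP.
    exact: fmorph_inj.
  - by rewrite filter_uniq.
  move=> x; rewrite mem_filter rsE; apply/mapP/andP => [[u] | [x1 /eqP xz]].
    rewrite mem_enum inE => /andP[/norm0[u1 u2] uz] ->; split; last exact: uz.
    rewrite /w -(inj_eq (mulIf u2)) divfK // -subr_eq0.
    have -> : f s + f u * I - -1 * (f s - f u * I) = 2 * f s by ring.
    by rewrite mulf_neq0.
  have x0 : x != 0.
    apply: contra_neq z0 => x0; rewrite -xz x0 expr0n.
    by case: (quarter g) q0; rewrite ?eqxx.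
  have x1' : x + 1 != 0 by rewrite addr_eq0.
  (* Since 4 [quarter g] is g - 1 or g + 1, this says that x^g is x or its inverse. *)
  have x4 : x ^+ (4 * quarter g) = 1 by rewrite mulnC exprM xz.
  (* The solution of (s + t I)/(s - t I) = x. It is fixed by Frobenius, hence comes from F_g: when g
     = 3 mod 4, inverting x and negating I compensate each other. *)
  pose t := f s * (x - 1) / (I * (x + 1)).
  have [u tu] : exists u, f u = t.
    apply: (Fp_embedding_image g_pr).
    rewrite -(pFrobenius_autE gK) /t fmorph_div !rmorphM rmorphB rmorphD rmorph1 /=.
    have fsg : f s ^+ g = f s.
      by rewrite -rmorphXn /= -[X in _ ^+ X](card_Fp g_pr) expf_card.
    rewrite !pFrobenius_autE fsg (sqrtN1_expr_pchar I2) //.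
    case: ifP => /eqP g4.
      have -> : x ^+ g = x by rewrite [X in _ ^+ X](quarter_mod1 g4) exprD x4 mul1r.
      by [].
    have xV : x ^+ g = x^-1.
      apply: (mulIf x0); rewrite mulVf // -exprSr -[g.+1]addn1 -quarter_mod3 //.
      exact: odd_mod4_neq1.
    by rewrite xV; field; rewrite x1' I0 x0 oppr_eq0.
  have tp : f s + f u * I = f s * 2 * x / (x + 1) by rewrite tu /t; field; rewrite x1' I0.
  have tm : f s - f u * I = f s * 2 / (x + 1) by rewrite tu /t; field; rewrite x1' I0.
  have wu : w u = x by rewrite /w tp tm; field; rewrite x1' a0 K2.
  exists u => //; rewrite mem_enum inE -(fmorph_eq0 f) -normE.
  rewrite tp tm !mulf_neq0 ?invr_eq0 //=; apply/eqP.
  by rewrite /qratio -/(w u) wu.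
have := count_predC (pred1 (-1)) rs.
rewrite rs_size count_uniq_mem // rsE => E.
by rewrite size_filter -[LHS](addKn ((-1) ^+ quarter g == z)) E.
Qed.

End QratioCount.

(** * Good models of y^2 = x^3 - g x *)

Section WeierstrassSubst.

Context {R : comNzRingType} {g r s t b1 b2 b3 b4 b6 : R}
  (e1 : b1 = 0 + 2 * s) (e2 : b2 = 0 - s * 0 + 3 * r - s ^+ 2)
  (e3 : b3 = 0 + r * 0 + 2 * t)
  (e4 : b4 = - g - s * 0 + 2 * r * 0 - (t + r * s) * 0 + 3 * r ^+ 2 - 2 * s * t)
  (e6 : b6 = 0 + r * - g + r ^+ 2 * 0 + r ^+ 3 - t * 0 - t ^+ 2 - r * t * 0).

(** With b_i = u^i a_i, this is the invariance of -c4. Together with [weierstrass_c6] it eliminates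
    r, s and t, which need not be reduced modulo p. *)
Lemma weierstrass_c4 :
  48 * b4 - (4 * b2 + b1 ^+ 2) ^+ 2 + 24 * b1 * b3 = - 48 * g.
Proof. by rewrite e1 e2 e3 e4; ring. Qed.

(** The relation c6 = 0, with the usual quantity b4 of the Weierstrass equation eliminated by means
    of c4. *)
Lemma weierstrass_c6 :
  1728 * b6 - (4 * b2 + b1 ^+ 2) ^+ 3 + 432 * b3 ^+ 2
    = - 144 * g * (4 * b2 + b1 ^+ 2).
Proof. by rewrite e1 e2 e3 e6; ring. Qed.

Lemma weierstrass_disc_subst :
  weierstrass_disc (Weierstrass b1 b2 b3 b4 b6) = 64 * g ^+ 3.
Proof. by rewrite /weierstrass_disc /= e1 e2 e3 e4 e6; ring. Qed.

End WeierstrassSubst.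

(** When 2 and 3 are invertible, completing the square and the cube recovers r, s and t from u and
    the coefficients. The c4 and c6 relations then make the affine substitution carry one curve to
    the other. *)
Lemma card_weierstrass_short {F : finFieldType} (F2 : 2 != 0 :> F) (F3 : 3 != 0 :> F)
    (u a1 a2 a3 a4 a6 g : F) :
  u != 0 ->
  u ^+ 4 * (48 * a4 - (4 * a2 + a1 ^+ 2) ^+ 2 + 24 * a1 * a3) = - 48 * g ->
  u ^+ 6 * (1728 * a6 - (4 * a2 + a1 ^+ 2) ^+ 3 + 432 * a3 ^+ 2)
    = - 144 * g * u ^+ 2 * (4 * a2 + a1 ^+ 2) ->
  #|[set P : F * F | on_weierstrass (Weierstrass a1 a2 a3 a4 a6) P.1 P.2]|
    = #|[set P : F * F | P.2 ^+ 2 == P.1 ^+ 3 - g * P.1]|.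
Proof.
have F12 : 12 != 0 :> F.
  have -> : 12 = 2 ^+ 2 * 3 :> F by ring.
  by rewrite mulf_neq0 // expf_neq0.
move=> u0 E4 E6; pose b2 := 4 * a2 + a1 ^+ 2.
pose s := u * a1 / 2; pose r := u ^+ 2 * b2 / (2 ^+ 2 * 3); pose t := u ^+ 3 * a3 / 2.
have D4 : u ^+ 4 * a4 = - g + 3 * r ^+ 2 - 2 * s * t.
  have c0 : 2 ^+ 4 * 3 != 0 :> F by rewrite mulf_neq0 // expf_neq0.
  apply: (mulfI c0).
  transitivity (u ^+ 4 * (48 * a4 - (4 * a2 + a1 ^+ 2) ^+ 2 + 24 * a1 * a3)
    + u ^+ 4 * (b2 ^+ 2 - 24 * a1 * a3)); first by rewrite /b2; ring.
  by rewrite E4 /r /s /t; field; rewrite ?F2 ?F12.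
have D6 : u ^+ 6 * a6 = - g * r + r ^+ 3 - t ^+ 2.
  have c0 : 2 ^+ 6 * 3 ^+ 3 != 0 :> F by rewrite mulf_neq0 // expf_neq0.
  apply: (mulfI c0).
  transitivity (u ^+ 6 * (1728 * a6 - (4 * a2 + a1 ^+ 2) ^+ 3 + 432 * a3 ^+ 2)
    + u ^+ 6 * (b2 ^+ 3 - 432 * a3 ^+ 2)); first by rewrite /b2; ring.
  by rewrite E6 -/b2 /r /t; field; rewrite ?F2 ?F12.
have D1 : 2 * s - u * a1 = 0 by rewrite /s; field.
have D3 : 2 * t - u ^+ 3 * a3 = 0 by rewrite /t; field.
have D2 : s ^+ 2 - 3 * r + u ^+ 2 * a2 = 0 by rewrite /s /r /b2; field; rewrite ?F2 ?F12.
clearbody b2 s r t.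
pose h (P : F * F) := (u ^+ 2 * P.1 + r, u ^+ 3 * P.2 + s * u ^+ 2 * P.1 + t).
have h_inj : injective h.
  move=> [x y] [x' y'] /eqP; rewrite xpair_eqE /= => /andP[/eqP/addIr E1 /eqP/addIr E2].
  have {}E1 := mulfI (expf_neq0 2 u0) E1; rewrite E1 in E2 *.
  by rewrite (mulfI (expf_neq0 3 u0) (addIr _ E2)).
rewrite -[RHS](card_preimset _ h_inj); apply: eq_card => -[x y].
rewrite !inE /on_weierstrass /= -subr_eq0 -[RHS]subr_eq0.
set V := (X in X == 0); set V' := (X in _ = (X == 0)).
suff -> : V' = u ^+ 6 * V by rewrite mulf_eq0 expf_eq0 /= (negPf u0).
apply/eqP; rewrite -subr_eq0; apply/eqP.
transitivity (u ^+ 5 * x * y * (2 * s - u * a1) + u ^+ 3 * y * (2 * t - u ^+ 3 * a3)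
  + u ^+ 4 * x ^+ 2 * (s ^+ 2 - 3 * r + u ^+ 2 * a2)
  + u ^+ 2 * x * (u ^+ 4 * a4 - (- g + 3 * r ^+ 2 - 2 * s * t))
  + (u ^+ 6 * a6 - (- g * r + r ^+ 3 - t ^+ 2))).
  by rewrite /V /V'; ring.
by rewrite D1 D2 D3 D4 D6 !subrr !mulr0 !addr0.
Qed.

Section GoodModel.

Context {g p : nat} (p_pr : prime p) (p_gt3 : (3 < p)%N) (png : ~~ (p %| g)%N).

Let p_odd : odd p.
Proof. by case: (even_prime p_pr) => // p2; move: p_gt3; rewrite p2. Qed.

Lemma Fp_int_eq0 (a : int) : (a%:~R == 0 :> 'F_p) = (p%:Z %| a)%Z.
Proof.
rewrite dvdzE; case: a => n; rewrite ?NegzE ?mulrNz ?oppr_eq0 ?abszN -pmulrn.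
all: by rewrite -(dvdn_pcharf (pchar_Fp p_pr)).
Qed.

Lemma Fp_small_neq0 (n : nat) : (0 < n)%N -> (n < p)%N -> n%:R != 0 :> 'F_p.
Proof.
move=> n0 np; rewrite -(dvdn_pcharf (pchar_Fp p_pr)).
by apply/negP => /(dvdn_leq n0); rewrite leqNgt np.
Qed.

Let F2 : 2 != 0 :> 'F_p. Proof. by apply: Fp_small_neq0 => //; lia. Qed.
Let F3 : 3 != 0 :> 'F_p. Proof. by apply: Fp_small_neq0 => //; lia. Qed.

Lemma dvd_64g3 : ~~ (p%:Z %| 64 * g%:Z ^+ 3)%Z.
Proof.
have gp0 : g%:R != 0 :> 'F_p by rewrite -(dvdn_pcharf (pchar_Fp p_pr)).
rewrite -Fp_int_eq0.
have -> : (64 * g%:Z ^+ 3)%:~R = 2 ^+ 6 * g%:R ^+ 3 :> 'F_p by ring.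
exact: mulf_neq0 (expf_neq0 6 F2) (expf_neq0 3 gp0).
Qed.

Lemma curve_E_good : good_model (curve_E g) p (Weierstrass 0 0 0 (- g%:Z) 0).
Proof.
split.
  exists 1, 0, 0, 0; split; rewrite ?oner_eq0 //=; try by ring.
  by split; rewrite ?rmorphN /=; ring.
have -> : weierstrass_disc (Weierstrass 0 0 0 (- g%:Z) 0) = 64 * g%:Z ^+ 3.
  by rewrite /weierstrass_disc /=; ring.
exact: dvd_64g3.
Qed.

(** From u^12 disc(W) = 64 g^3, with both discriminants prime to p, the fraction u = n/d in lowest
    terms is a p-adic unit. The invariant relations are then cleared of denominators. *)
Lemma good_model_unit (W : weierstrass int) : good_model (curve_E g) p W ->
  exists n d : int, [/\ ~~ (p%:Z %| n)%Z, ~~ (p%:Z %| d)%Z,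
    n ^+ 4 * (48 * wa4 W - (4 * wa2 W + wa1 W ^+ 2) ^+ 2 + 24 * wa1 W * wa3 W)
      = - 48 * g%:Z * d ^+ 4 &
    n ^+ 6 * (1728 * wa6 W - (4 * wa2 W + wa1 W ^+ 2) ^+ 3 + 432 * wa3 W ^+ 2)
      = - 144 * g%:Z * n ^+ 2 * (4 * wa2 W + wa1 W ^+ 2) * d ^+ 4].
Proof.
case: W => a1 a2 a3 a4 a6 [[u [r [s [t [u0 /= e1 e2 e3 [e4 e6]]]]]] pD].
pose n := numq u; pose d := denq u.
have d0 : d%:~R != 0 :> rat by rewrite intr_eq0 denq_neq0.
have uE : u * d%:~R = n%:~R by rewrite -{1}(divq_num_den u) divfK.
have E4 : u ^+ 4 * (48 * a4%:~R - (4 * a2%:~R + a1%:~R ^+ 2) ^+ 2 + 24 * a1%:~R * a3%:~R)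
    = - 48 * g%:R :> rat.
  transitivity (48 * (u ^+ 4 * a4%:~R) - (4 * (u ^+ 2 * a2%:~R) + (u * a1%:~R) ^+ 2) ^+ 2
    + 24 * (u * a1%:~R) * (u ^+ 3 * a3%:~R)); first by ring.
  exact: weierstrass_c4 e1 e2 e3 e4.
have E6 : u ^+ 6 * (1728 * a6%:~R - (4 * a2%:~R + a1%:~R ^+ 2) ^+ 3 + 432 * a3%:~R ^+ 2)
    = - 144 * g%:R * u ^+ 2 * (4 * a2%:~R + a1%:~R ^+ 2) :> rat.
  transitivity (1728 * (u ^+ 6 * a6%:~R) - (4 * (u ^+ 2 * a2%:~R) + (u * a1%:~R) ^+ 2) ^+ 3
    + 432 * (u ^+ 3 * a3%:~R) ^+ 2); first by ring.
  transitivity (- 144 * g%:R * (4 * (u ^+ 2 * a2%:~R) + (u * a1%:~R) ^+ 2) : rat);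
    last by ring.
  exact: weierstrass_c6 e1 e2 e3 e6.
have ED : u ^+ 12 * (weierstrass_disc (Weierstrass a1 a2 a3 a4 a6))%:~R = 64 * g%:R ^+ 3 :> rat.
  rewrite /weierstrass_disc /=.
  pose b1 := u * a1%:~R; pose b2 := u ^+ 2 * a2%:~R; pose b3 := u ^+ 3 * a3%:~R.
  pose b4 := u ^+ 4 * a4%:~R; pose b6 := u ^+ 6 * a6%:~R.
  transitivity (weierstrass_disc (Weierstrass b1 b2 b3 b4 b6)).
    by rewrite /weierstrass_disc /= /b1 /b2 /b3 /b4 /b6; ring.
  exact: weierstrass_disc_subst e1 e2 e3 e4 e6.
have EDz : n ^+ 12 * weierstrass_disc (Weierstrass a1 a2 a3 a4 a6) = 64 * g%:Z ^+ 3 * d ^+ 12.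
  apply: (@intr_inj rat); rewrite !(rmorphM, rmorphXn) /= -uE exprMn mulrAC ED.
  by ring.
have p64 := dvd_64g3.
move: (weierstrass_disc _) (64 * _) pD EDz p64 => D c {ED} pD EDz p64.
have pmul a b := @Euclid_dvdzM p a b p_pr.
have pexp (a : int) (k : nat) : (0 < k)%N -> (p%:Z %| a ^+ k)%Z = (p%:Z %| a)%Z.
  by move=> k0; rewrite -!Fp_int_eq0 rmorphXn /= expf_eq0 k0.
have Ediv : (p%:Z %| n)%Z || (p%:Z %| D)%Z = (p%:Z %| c)%Z || (p%:Z %| d)%Z.
  have p1 := pexp n 12%N isT.
  have p2 := pexp d 12%N isT.
  by rewrite -p1 -p2 -[LHS]pmul EDz; apply: pmul.
have ndp : ~~ ((p%:Z %| n)%Z && (p%:Z %| d)%Z).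
  apply/negP => /andP[pn pd].
  have := coprime_num_den u; rewrite -/n -/d => cop.
  have : (p %| gcdn `|n| `|d|)%N by rewrite dvdn_gcd -[X in (X %| _)%N]/(`|p%:Z|%N) -!dvdzE pn.
  by rewrite (eqP cop) dvdn1 => /eqP p1; move: p_gt3; rewrite p1.
exists n, d; split.
- apply: contra ndp => pn; rewrite pn /=.
  by move: Ediv; rewrite pn (negPf p64) /= => <-.
- apply: contra ndp => pd; rewrite pd andbT.
  by move: Ediv; rewrite pd (negPf pD) orbT orbF.
- apply: (@intr_inj rat); transitivity (d%:~R ^+ 4 * (- 48 * g%:R) : rat); last by ring.
  by rewrite -E4; ring: uE.
- apply: (@intr_inj rat).
  transitivity (d%:~R ^+ 6 * (- 144 * g%:R * u ^+ 2 * (4 * a2%:~R + a1%:~R ^+ 2)) : rat).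
    by rewrite -E6; ring: uE.
  by ring: uE.
Qed.

(** [frobenius_trace] picks an arbitrary good model; this makes the choice harmless. *)
Lemma good_model_card (W : weierstrass int) : good_model (curve_E g) p W ->
  #|[set P : 'F_p * 'F_p | on_weierstrass (map_weierstrass intr W) P.1 P.2]|
    = #|[set P : 'F_p * 'F_p | P.2 ^+ 2 == P.1 ^+ 3 - g%:R * P.1]|.
Proof.
move=> /good_model_unit[n [d [pn pd]]].
case: W => a1 a2 a3 a4 a6 /= E4 E6.
have n0 : n%:~R != 0 :> 'F_p by rewrite Fp_int_eq0.
have d0 : d%:~R != 0 :> 'F_p by rewrite Fp_int_eq0.
apply: (@card_weierstrass_short _ F2 F3 (n%:~R / d%:~R)).
- by rewrite mulf_neq0 ?invr_eq0.
- apply: (mulIf (expf_neq0 4 d0)); rewrite exprMn exprVn mulrAC divfK ?expf_neq0 //.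
  transitivity ((- 48 * g%:Z * d ^+ 4)%:~R : 'F_p); last by ring.
  by rewrite -E4; ring.
- apply: (mulIf (expf_neq0 6 d0)); rewrite exprMn exprVn mulrAC divfK ?expf_neq0 //.
  transitivity ((- 144 * g%:Z * n ^+ 2 * (4 * a2 + a1 ^+ 2) * d ^+ 4)%:~R : 'F_p).
    by rewrite -E6; ring.
  by field.
Qed.

Lemma card_cubic :
  (#|[set P : 'F_p * 'F_p | P.2 ^+ 2 == P.1 ^+ 3 - g%:R * P.1]|%:Z
    = p%:Z + \sum_(x : 'F_p) phi (x ^+ 3 - g%:R * x))%R.
Proof.
transitivity (\sum_(x : 'F_p) (1 + phi (x ^+ 3 - g%:R * x))); last first.
  by rewrite big_split /= sumr_const card_Fp // natz.
under eq_bigr do rewrite -(card_sqrt p_pr p_odd).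
rewrite -sum1_card (partition_big (fun P => P.1) predT) //= -natz natr_sum.
apply: eq_bigr => x _; rewrite natz; congr Posz.
have x_inj : injective (fun y : 'F_p => (x, y)) by move=> a b [].
rewrite sum1dep_card -[RHS](card_imset _ x_inj).
apply: eq_card => -[x' y]; rewrite !inE /=; apply/andP/imsetP => [[E /eqP xE]|[z]].
  by exists y; rewrite ?inE -?xE.
by rewrite inE => E [-> ->].
Qed.

Lemma frobenius_trace_curve_E :
  good_reduction (curve_E g) p /\
  frobenius_trace (curve_E g) p = - \sum_(x : 'F_p) phi (x ^+ 3 - g%:R * x).
Proof.
have good : good_reduction (curve_E g) p by eexists; exact: curve_E_good.
split=> //; rewrite /frobenius_trace; case: pselect => // ex.
case: (cid ex) => W /= Wgood.
rewrite /trace_model PoszD good_model_card // card_cubic.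
by ring.
Qed.

End GoodModel.

(** The cubic is odd in x, and phi(-1) = -1. *)
Lemma trace_sum_eq0 (g p : nat) : prime p -> (p %% 4 = 3)%N ->
  \sum_(x : 'F_p) phi (x ^+ 3 - g%:R * x) = 0.
Proof.
move=> p_pr p3; have [h hP] := Fp_prim_root p_pr.
set S := \sum_(_ | _) _.
have : S = - S.
  rewrite {1}/S (reindex_inj oppr_inj) -sumrN; apply: eq_bigr => x _.
  rewrite -(phiN p_pr hP) //; last by lia.
  by congr phi; ring.
by lia.
Qed.

(** * Asymptotics *)

Local Open Scope classical_set_scope.

(* For divergent u both limits are the default point 0. *)
Lemma limn_scale {R : realType} (c : R) (u v : R^nat) (N : nat) : c != 0 ->
  (forall n, (N <= n)%N -> v n = c * u n) -> limn v = c * limn u.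
Proof.
move=> c0 vu.
have E : v @ \oo = (fun n => c * u n) @ \oo.
  rewrite eqEsubset; split; apply: near_eq_cvg; exists N => // n /= Nn; by rewrite vu.
rewrite [LHS](_ : _ = lim ((fun n => c * u n) @ \oo)); last by rewrite E.
have [cu|ncu] := pselect (cvgn u).
  by apply: cvg_lim => //; exact: (cvgZl_tmp cu).
rewrite (dvgP ncu) [LHS]dvgP ?mulr0 // => cvg_cu; apply: ncu.
suff -> : u = (fun n => c^-1 * (c * u n)) by exact: is_cvgZl_tmp.
by apply/funext => n; rewrite mulKf.
Qed.

Lemma sqrt_log_unbounded {R : realType} (M : R) : \forall x \near +oo, M <= sqrt_log x.
Proof.
exists (Num.max 1 ((4 * M) ^+ 4)); split; first exact: num_real.
move=> x; rewrite gt_max => /andP[x1 xM].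
have x0 : 0 < x by apply: lt_trans x1.
(* With y = x^(1/4), ln x = 4 ln y <= 4 y, so sqrt x / ln x >= y / 4. *)
pose y := Num.sqrt (Num.sqrt x).
have sqrtx0 : 0 < Num.sqrt x by rewrite sqrtr_gt0.
have y0 : 0 < y by rewrite sqrtr_gt0.
have y2 : y ^+ 2 = Num.sqrt x by rewrite sqr_sqrtr ?sqrtr_ge0.
have y4 : y ^+ 4 = x by rewrite (exprM y 2 2) y2 sqr_sqrtr ?ltW.
have yM : 4 * M <= y.
  have [M0|/ltW M0] := leP M 0; first by apply: le_trans (ltW y0); rewrite pmulr_rle0.
  rewrite -(@ler_pXn2r _ 4) ?nnegrE ?(ltW y0) //; first by rewrite y4 ltW.
  by rewrite mulr_ge0.
have lnx : 0 < ln x <= 4 * y.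
  rewrite ln_gt0 //= -y4 lnXn // -[ln y *+ 4]mulr_natl ler_pM2l //.
  by rewrite ltW // ln_sublinear.
case/andP: lnx => ln0 lny; rewrite /sqrt_log -y2 ler_pdivlMr //.
have [M0|/ltW M0] := leP M 0.
  by apply: (@le_trans _ _ 0); [rewrite pmulr_lle0 | rewrite sqr_ge0].
apply: (@le_trans _ _ (M * (4 * y))); first by rewrite ler_wpM2l.
by rewrite mulrA [M * 4]mulrC expr2 ler_wpM2r // ltW.
Qed.

(* If C = 0, each h t is equivalent to 0, hence eventually 0, and f is bounded. *)
Lemma asymp_sqrt_log_sum {R : realType} {T : finType} (A : {set T}) (f : R -> R)
    (h : T -> R -> R) (B C : R) :
  (forall x, `|f x - \sum_(t in A) h t x| <= B) ->
  (forall t, t \in A -> h t ~_(pinfty_nbhs R) (fun x => C * sqrt_log x)) ->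
  asymp_sqrt_log f (#|A|%:R * C).
Proof.
move=> fB hC.
have h_near t e : t \in A -> 0 < e ->
    \forall x \near +oo, `|h t x - C * sqrt_log x| <= e * `|C * sqrt_log x|.
  by move=> tA e0; have /eqaddoP/(_ e e0) := hC t tA.
have sum_near e : 0 < e -> \forall x \near +oo,
    `|f x - #|A|%:R * C * sqrt_log x| <= B + #|A|%:R * (e * `|C * sqrt_log x|).
  move=> e0.
  have all_near : \forall x \near +oo, forall t, t \in A ->
      `|h t x - C * sqrt_log x| <= e * `|C * sqrt_log x|.
    have : \forall x \near +oo, forall t, t \in enum A ->
        `|h t x - C * sqrt_log x| <= e * `|C * sqrt_log x|.
      have : {subset enum A <= A} by move=> t; rewrite mem_enum.
      elim: (enum A) => [|t s IH'] sA; first by apply: nearW => x t.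
      have tA : t \in A by apply: sA; rewrite mem_head.
      have IH : {subset s <= A} by move=> u us; apply: sA; rewrite inE us orbT.
      have := IH' IH.
      apply: filterS2 (h_near t e tA e0) => x ht hs u; rewrite inE => /orP[/eqP -> //|].
      exact: hs.
    by apply: filterS => x hx t tA; apply: hx; rewrite mem_enum.
  apply: filterS all_near => x hx.
  have -> : f x - #|A|%:R * C * sqrt_log x =
      (f x - \sum_(t in A) h t x) + \sum_(t in A) (h t x - C * sqrt_log x).
    by rewrite sumrB sumr_const addrA subrK; congr (_ - _); rewrite -[RHS]mulr_natl mulrA.
  apply: (le_trans (ler_normD _ _)); rewrite lerD ?fB //.
  apply: (le_trans (ler_norm_sum _ _ _)).
  rewrite mulr_natl -sumr_const; exact: ler_sum.
have [NC0|NC0] := eqVneq (#|A|%:R * C) 0; rewrite /asymp_sqrt_log.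
  rewrite NC0 eqxx; apply/eqOP; exists B; split; first exact: num_real.
  move=> k Bk; have := sum_near 1 ltr01; apply: filterS => x.
  rewrite NC0 mul0r subr0 mul1r normrM mulrA -[#|A|%:R]ger0_norm // -normrM NC0.
  by rewrite normr0 mul0r addr0 normr1 mulr1 => /le_trans; apply; apply: ltW.
rewrite (negPf NC0); apply/eqaddoP => e e0.
(* One half of e absorbs the constant B, the other the errors of the summands. *)
have e2 : 0 < e / 2 by rewrite divr_gt0.
have NC1 : 0 < e / 2 * `|#|A|%:R * C| by rewrite mulr_gt0 // normr_gt0.
have := sqrt_log_unbounded (B / (e / 2 * `|#|A|%:R * C|)).
apply: filterS2 (sum_near _ e2) => x le1 le2.
apply: (le_trans le1).
have -> : #|A|%:R * (e / 2 * `|C * sqrt_log x|) = e / 2 * `|#|A|%:R * C * sqrt_log x|.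
  by rewrite !normrM normr_nat; ring.
rewrite [X in _ <= X * _](_ : e = e / 2 + e / 2); last by field.
rewrite mulrDl lerD2r; move: le2; rewrite ler_pdivrMr // => /le_trans; apply.
by rewrite [X in _ <= _ * X]normrM [leRHS]mulrA [leLHS]mulrC ler_wpM2l ?ler_norm // ltW.
Qed.

Local Close Scope classical_set_scope.

Lemma prime_countE {R : realType} (P : nat -> Prop) (x : R) :
  prime_count P x = (\sum_(0 <= p < (Num.truncn x).+1) (prime p && `[< P p >]))%N.
Proof.
by rewrite /prime_count -sum1_count big_mkcond /= /index_iota subn0; apply: eq_bigr.
Qed.

Lemma sum_eventually_zero {V : numDomainType} (d : nat -> V) (b n : nat) :
  (forall p, (b <= p)%N -> d p = 0) ->
  `|\sum_(0 <= p < n) d p| <= \sum_(0 <= p < b) `|d p|.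
Proof.
move=> d0; have [nb|bn] := leqP n b.
  apply: (le_trans (ler_norm_sum _ _ _)).
  rewrite [leRHS](@big_cat_nat _ _ _ n) //= lerDl.
  by apply: sumr_ge0.
rewrite (@big_cat_nat _ _ _ b) ?(ltnW bn) //=.
have -> : \sum_(b <= p < n) d p = 0.
  by rewrite big_nat big1 // => p /andP[bp _]; apply: d0.
by rewrite addr0; apply: ler_norm_sum.
Qed.

(** Only primes below b can violate the partition, and their contribution is bounded independently
    of x. *)
Lemma prime_count_partition {R : realType} {T : finType} (A : {set T})
    (P : nat -> Prop) (Q : T -> nat -> Prop) (b : nat) :
  (forall p, prime p -> (b <= p)%N -> P p -> exists2 t, t \in A & Q t p) ->
  (forall p t, prime p -> (b <= p)%N -> t \in A -> Q t p -> P p) ->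
  (forall p t t', Q t p -> Q t' p -> t = t') ->
  exists B : R, forall x : R,
    `|(prime_count P x)%:R - \sum_(t in A) (prime_count (Q t) x)%:R| <= B.
Proof.
move=> PQ QP Quniq.
pose d p : R := (prime p && `[< P p >])%:R - \sum_(t in A) (prime p && `[< Q t p >])%:R.
exists (\sum_(0 <= p < b) `|d p|) => x.
have -> : (prime_count P x)%:R - \sum_(t in A) (prime_count (Q t) x)%:R
    = \sum_(0 <= p < (Num.truncn x).+1) d p.
  rewrite sumrB prime_countE natr_sum; congr (_ - _).
  by rewrite exchange_big; apply: eq_bigr => t _; rewrite prime_countE natr_sum.
apply: sum_eventually_zero => p bp; rewrite /d.
have [p_pr|_] := boolP (prime p); last by rewrite big1 // subrr.
have [Pp|nPp] := pselect (P p).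
  have [t tA Qt] := PQ p p_pr bp Pp.
  rewrite (bigD1 t) //= !asboolT // big1 ?addr0 ?subrr // => t' /andP[_ t't].
  by rewrite asboolF // => Qt'; move: t't; rewrite (Quniq _ _ _ Qt Qt') eqxx.
rewrite asboolF // big1 ?subrr // => t tA.
by rewrite asboolF // => /(QP p t p_pr bp tA).
Qed.

(** * The Hardy-Littlewood constants *)

Lemma phi_sqrM {p : nat} (y c : 'F_p) : y != 0 -> phi (y ^+ 2 * c) = phi c.
Proof.
move=> y0; rewrite /phi mulf_eq0 expf_eq0 (negPf y0) /=.
case: eqP => // _; congr (if _ then _ else _); apply/existsP/existsP => -[x /eqP xE].
  exists (x / y); rewrite exprMn exprVn xE mulrC mulKf //.
  by rewrite expf_neq0.
by exists (y * x); rewrite exprMn xE.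
Qed.

Lemma legendreE {p : nat} (a : int) : prime p -> legendre a p = phi (a%:~R : 'F_p).
Proof.
move=> p_pr; rewrite /legendre /phi (Fp_int_eq0 p_pr); case: ifP => // _.
congr (if _ then _ else _); apply/existsP/existsP => -[x].
  rewrite eqz_mod_dvd -(Fp_int_eq0 p_pr) rmorphB rmorphXn /= subr_eq0 => xa.
  by exists ((x : nat)%:R).
move=> xa; have xp : (x < p)%N by rewrite -[X in (_ < X)%N](Fp_cast p_pr).
exists (Ordinal xp); rewrite eqz_mod_dvd -(Fp_int_eq0 p_pr) rmorphB rmorphXn /= subr_eq0.
by rewrite -pmulrn natr_Zp.
Qed.

Lemma legendre_sqrM {p : nat} (k a : int) : prime p -> ~~ (p%:Z %| k)%Z ->
  legendre (k ^+ 2 * a) p = legendre a p.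
Proof.
move=> p_pr pk; rewrite !legendreE // rmorphM rmorphXn /= phi_sqrM //.
by rewrite Fp_int_eq0.
Qed.

Lemma legendreN1 {g : nat} : prime g -> odd g ->
  legendre (-1) g = if (g %% 4 == 1)%N then 1 else -1.
Proof.
move=> g_pr g_odd; have [h hP] := Fp_prim_root g_pr.
rewrite legendreE // rmorphN1; case: eqP => g4.
  rewrite /phi oppr_eq0 oner_eq0; case: existsP => // -[]; exists (h ^+ (g.-1 %/ 4)).
  rewrite -exprM -(Fp_neg1 g_pr hP g_odd); apply/eqP; congr (_ ^+ _).
  by have := prime_gt1 g_pr; lia.
by rewrite (phiN g_pr hP g_odd) ?phi1 //; lia.
Qed.

Lemma natr_sub1_neq0 (R : realType) {n : nat} : (1 < n)%N -> n%:R - 1 != 0 :> R.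
Proof. by move=> n1; rewrite subr_eq0 -[1]/(1%:R) eqr_nat; lia. Qed.

Lemma sub_legendreN1_neq0 (R : realType) {g : nat} : prime g -> odd g ->
  g%:R - 1 - (legendre (-1) g)%:~R != 0 :> R.
Proof.
move=> g_pr g_odd; rewrite legendreN1 //; case: ifP => /eqP g4; last first.
  by rewrite rmorphN1 opprK subrK pnatr_eq0 -lt0n prime_gt0.
rewrite -addrA -opprD -[1 + _]/(2%:R) subr_eq0 eqr_nat.
by apply: contraTneq g_odd => ->.
Qed.

Lemma prime_prod_eq {R : realType} (A B : pred nat) (F G : nat -> R) :
  (forall p, prime p -> (if A p then F p else 1) = (if B p then G p else 1)) ->
  prime_prod A F = prime_prod B G.
Proof.
move=> AB; rewrite /prime_prod; congr (limn _); apply/funext => n.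
rewrite big_mkcond [RHS]big_mkcond /=; apply: eq_bigr => p _.
by case: (boolP (prime p)) => //= /AB.
Qed.

(** Partial products beyond g differ by exactly F g; as this is nonzero, both products converge or
    diverge together. *)
Lemma prime_prod_factor {R : realType} (A : pred nat) (F : nat -> R) (g : nat) :
  prime g -> A g -> F g != 0 ->
  prime_prod A F = F g * prime_prod (fun p => A p && (p != g)) F.
Proof.
move=> g_pr Ag Fg; apply: (limn_scale _ _ _ g.+1) => // n gn.
rewrite big_mkcond (bigD1_seq g) ?iota_uniq ?mem_index_iota //= g_pr Ag /=.
congr (_ * _); rewrite big_mkcond [RHS]big_mkcond; apply: eq_bigr => p _.
by case: (prime p); case: (A p); case: (p != g).
Qed.

(** For (4 g m + t)^2 + s^2 the discriminant is -(8 g s)^2, gcd(2, a + b) = 2 and sqrt a = 4 g. The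
    odd part D is g or g^2, so D / totient D = g / (g - 1) for every t. Primes dividing s have
    symbol 0 and contribute the factor 1. *)
Lemma HL_const_class {R : realType} {g : nat} (g_pr : prime g) (g_odd : odd g)
    (s : int) (t : nat) :
  HL_const R (16 * g ^ 2)%N%:Z (8 * g * t)%N%:Z (s ^+ 2 + (t ^ 2)%N%:Z) =
  1 / (2 * (g%:R - 1)) *
  prime_prod (fun p => ~~ (p%:Z %| 2 * g%:Z * s)%Z)
    (fun p => 1 - (legendre (-1) p)%:~R / (p%:R - 1)).
Proof.
have g0 := prime_gt0 g_pr; have g1 := prime_gt1 g_pr.
rewrite /HL_const; congr (_ * _); last first.
  have -> : (8 * g * t)%N%:Z ^+ 2 - 4 * (16 * g ^ 2)%N%:Z * (s ^+ 2 + (t ^ 2)%N%:Z)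
     = (8 * g%:Z * s) ^+ 2 * -1 by rewrite -?mulnn !PoszM; ring.
  apply: prime_prod_eq => p p_pr.
  have pmul a b := @Euclid_dvdzM p a b p_pr.
  have -> : (2 * (16 * g ^ 2)%N%:Z : int) = 2 * 2 * 2 * 2 * 2 * g%:Z * g%:Z.
    by rewrite -?mulnn !PoszM; ring.
  rewrite !pmul !orbb -!orbA orbb.
  have [//|p2] := boolP (p%:Z %| 2)%Z; have [//|pg] := boolP (p%:Z %| g%:Z)%Z.
  have [ps|ps] /= := boolP (p%:Z %| s)%Z; last first.
    rewrite legendre_sqrM // !pmul (negPf pg) (negPf ps) !orbF.
    have -> : (8 : int) = 2 * 2 * 2 by ring.
    by rewrite !pmul !orbb.
  rewrite /legendre.
  have -> : (p%:Z %| (8 * g%:Z * s) ^+ 2 * -1)%Z.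
    by rewrite expr2 !pmul ps !orbT.
  by rewrite mul0r subr0.
have -> : gcdn 2 `|(16 * g ^ 2)%N%:Z + (8 * g * t)%N%:Z| = 2%N.
  apply/gcdn_idPl; rewrite -PoszD absz_nat.
  by rewrite dvdn_add ?dvdn_mulr.
have -> : Num.sqrt ((16 * g ^ 2)%N%:Z%:~R : R) = 4 * g%:R.
  have -> : ((16 * g ^ 2)%N%:Z%:~R : R) = (4 * g%:R) ^+ 2.
    by rewrite -pmulrn natrM natrX; ring.
  by rewrite sqrtr_sqr ger0_norm // mulr_ge0.
set D := (_`_ _)%N.
have g2 : (g \in 2^')%N by rewrite !inE; apply: contraTneq g_odd => ->.
have gnat : ((2^').-nat g)%N by rewrite pnatE.
have gcd_gt0 : (0 < gcdn `|(16 * g ^ 2)%N%:Z| `|(8 * g * t)%N%:Z|)%N.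
  by rewrite gcdn_gt0 !absz_nat muln_gt0 expn_gt0 g0.
have gD : (g %| D)%N.
  rewrite -(part_pnat_id gnat); apply: partn_dvd => //.
  by rewrite !absz_nat dvdn_gcd dvdn_mull ?dvdn_exp // -mulnA mulnCA dvdn_mulr.
have Dg : (D %| g ^ 2)%N.
  have -> : (g ^ 2 = (16 * g ^ 2)`_(2^'))%N.
    rewrite partnM ?expn_gt0 ?g0 // [X in (_ * X)%N]part_pnat_id ?pnatX ?gnat //.
    by rewrite part_p'nat ?mul1n // pnatNK.
  by apply: partn_dvd; rewrite ?muln_gt0 ?expn_gt0 ?g0 // dvdn_gcdl.
have gR0 : g%:R != 0 :> R by rewrite pnatr_eq0; lia.
have gR1 := natr_sub1_neq0 R g1.
have -> : D%:R / (totient D)%:R = g%:R / (g%:R - 1) :> R.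
  have /(dvdn_pfactor _ _ g_pr)[[|e] _ De] := Dg.
    by move: gD; rewrite De dvdn1 => /eqP E; move: g1; rewrite E.
  rewrite De totient_pfactor //= natrM !natrX exprS.
  have -> : (g.-1)%:R = g%:R - 1 :> R by rewrite -subn1 natrB.
  field.
  by rewrite gR1 expf_neq0.
by field; rewrite gR0 gR1.
Qed.

Lemma target_prod {R : realType} {g : nat} (g_pr : prime g) (g_odd : odd g) (s : int) :
  ~~ (g%:Z %| 2 * s)%Z ->
  prime_prod (fun p => ~~ (p%:Z %| 2 * s)%Z)
    (fun p => 1 - (legendre (-1) p)%:~R / (p%:R - 1) : R) =
  (1 - (legendre (-1) g)%:~R / (g%:R - 1)) *
  prime_prod (fun p => ~~ (p%:Z %| 2 * g%:Z * s)%Z)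
    (fun p => 1 - (legendre (-1) p)%:~R / (p%:R - 1)).
Proof.
move=> gs; have g1 := prime_gt1 g_pr.
have gR1 := natr_sub1_neq0 R g1.
rewrite (prime_prod_factor _ _ g) //; last first.
  rewrite -(inj_eq (mulIf gR1)) mulrBl divfK // mul0r mul1r.
  exact: sub_legendreN1_neq0.
congr (_ * _); apply: prime_prod_eq => p p_pr; congr (if _ then _ else _).
have pmul a b := @Euclid_dvdzM p a b p_pr.
rewrite !pmul dvdzE [X in _ || X || _]dvdzE /= (dvdn_prime2 p_pr g_pr).
by rewrite -!negb_or; congr (~~ _); rewrite -!orbA [(_ == _) || _]orbC.
Qed.

(** * Residue classes modulo 4 g *)

Lemma exprzN1_parity (k : int) : (-1 : int) ^ k = if (2 %| k)%Z then 1 else -1.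
Proof.
case: k => n; rewrite /exprz dvdzE dvdn2 -signr_odd /=.
  by case: (odd n).
by case: (odd n).
Qed.

(* The number of good classes with residue j mod 4. *)
Definition class_count (g : nat) (s : int) (j : nat) : nat :=
  if (2 %| s + j%:Z)%Z then 0%N
  else (quarter g - (4 %| (2 * (quarter g)%:Z - quartic_exp g s j%:Z)%R)%Z)%N.

Lemma class_count0 (g : nat) (s : int) (j : nat) : (2 %| s + j%:Z)%Z -> class_count g s j = 0%N.
Proof. by rewrite /class_count => ->. Qed.

Lemma class_count_even (g : nat) (s : int) (j : nat) : (2 %| s)%Z -> odd j ->
  class_count g s j = quarter g.
Proof.
move=> s2 j1; rewrite /class_count ifN; last by lia.
rewrite (_ : (_ %| _)%Z = false) ?subn0 //.
by rewrite /quartic_exp s2; apply/negP; case: ifP => _; lia.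
Qed.

Lemma class_count_odd (g : nat) (s : int) (j : nat) : ~~ (2 %| s)%Z -> ~~ odd j ->
  class_count g s j =
    (quarter g - (4 %| (2 * (quarter g)%:Z
      - (if (g %% 4 == 1)%N then s + j%:Z - 1 else s - 1))%R)%Z)%N.
Proof.
move=> s2 j1; rewrite /class_count ifN; last by lia.
by rewrite /quartic_exp (negPf s2).
Qed.

(** Two residues j have the right parity, each with q = [quarter g] classes, less one if its target
    value is (-1)^q, the value lost with the root -1. If k residues lose a class, delta = 1 - 2 k.
    For s even the target is an odd power of I, so k = 0. For s odd and g = 1 mod 4 the targets at j
    = 0, 2 are opposite, so k = 1; for g = 3 mod 4 they coincide, so k = 0 or 2. *)
Lemma class_count_sum {g : nat} (s : int) : odd g -> (1 < g)%N ->
  2 * (class_count g s 0 + class_count g s 1 + class_count g s 2 + class_count g s 3)%N%:Z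
    = g%:Z - 1 - (if (g %% 4 == 1)%N then 1 else -1) + delta g (2 * s).
Proof.
move=> g_odd g1; rewrite /delta exprzN1_parity.
have [s2|s2] := boolP (2 %| s)%Z.
  rewrite (class_count0 g s 0) ?addr0 // (class_count0 g s 2); last by lia.
  rewrite !class_count_even // [if (4 %| _)%Z then _ else _]ifT; last by lia.
  case: ifP => /eqP g4; first by have := quarter_mod1 g4; lia.
  by have := quarter_mod3 (odd_mod4_neq1 g_odd g4); lia.
rewrite (class_count0 g s 1); last by lia.
rewrite (class_count0 g s 3); last by lia.
rewrite !class_count_odd // [if (4 %| _)%Z then _ else _]ifN; last by lia.
case: ifP => /eqP g4.
  have := quarter_mod1 g4; move: (quarter g) => q gq.
  have [d0|d0] := boolP (4 %| 2 * q%:Z - (s + 0%N%:Z - 1))%Z.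
    have -> : (4 %| 2 * q%:Z - (s + 2%N%:Z - 1))%Z = false by lia.
    by lia.
  have -> : (4 %| 2 * q%:Z - (s + 2%N%:Z - 1))%Z by lia.
  by lia.
have gq := quarter_mod3 (odd_mod4_neq1 g_odd g4).
have -> : ((g%:Z + 1) %/ 4)%Z = (quarter g)%:Z by lia.
move: (quarter g) gq => q gq.
have -> : ((2 * s - 2) %/ 4)%Z = ((s - 1) %/ 2)%Z by lia.
have [d0|d0] := boolP (4 %| 2 * q%:Z - (s - 1))%Z.
  by rewrite ifT; lia.
by rewrite ifN; lia.
Qed.

Lemma odd_two_squares_mod4 {s m : int} {p : nat} :
  s ^+ 2 + m ^+ 2 = p%:Z -> ~~ (2 %| s + m)%Z -> (p %% 4 = 1)%N.
Proof.
have [s2|s2] := boolP (2 %| s)%Z; have [m2|m2] := boolP (2 %| m)%Z.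
- by lia.
- by have := even_sqr_mod8 _ s2; have := odd_sqr_mod8 _ m2; lia.
- by have := odd_sqr_mod8 _ s2; have := even_sqr_mod8 _ m2; lia.
- by lia.
Qed.

Lemma two_squares_ge {s : int} {k M p : nat} : s ^+ 2 + M%:Z ^+ 2 = p%:Z ->
  (`|s| ^ 2 + k ^ 2 <= p)%N -> (k <= M)%N.
Proof.
move=> sM; have <- : (`|s| ^ 2 + M ^ 2 = p)%N.
  apply/eqP; rewrite -eqz_nat PoszD -!mulnn !PoszM -!expr2 abszE.
  by rewrite real_normK ?num_real // sM.
by rewrite leq_add2l leq_exp2r.
Qed.

Section Classes.

Context {g : nat} (g_pr : prime g) (g_odd : odd g).
Context {K : closedFieldType} {I : K} (I2 : I ^+ 2 = -1) (f : {rmorphism 'F_g -> K}).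

Let g1 : (1 < g)%N. Proof. exact: prime_gt1. Qed.
Let gK := pchar_Fp_embedding g_pr f.
Let K2 := pchar_odd_neq2 gK g_odd.

Let cop4g : coprime 4 g.
Proof. by rewrite -[4%N]/(2 ^ 2)%N coprimeXl // coprime2n. Qed.

Definition residue_class (g M : nat) : 'I_4 * 'F_g := (inord (M %% 4), M%:R).

(* The representative in [0, 4g) of the class with residues ju mod 4 and mod g. *)
Definition class_repr (ju : 'I_4 * 'F_g) : nat := (chinese 4 g ju.1 ju.2 %% (4 * g))%N.

Lemma class_repr_mod4 ju : class_repr ju = ju.1 %[mod 4].
Proof. by rewrite /class_repr modn_dvdm ?dvdn_mulr // chinese_modl. Qed.

Lemma class_repr_modg ju : class_repr ju = ju.2 %[mod g].
Proof. by rewrite /class_repr modn_dvdm ?dvdn_mull // chinese_modr. Qed.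

Lemma class_reprK ju (M : nat) : M = class_repr ju %[mod 4 * g] -> residue_class g M = ju.
Proof.
move=> E; have E4 : M = class_repr ju %[mod 4] by apply: eqmod_dvd E; rewrite dvdn_mulr.
have Eg : M = class_repr ju %[mod g] by apply: eqmod_dvd E; rewrite dvdn_mull.
case: ju E4 Eg {E} => j u; rewrite class_repr_mod4 class_repr_modg /= => E4 Eg.
congr (_, _); apply: val_inj.
  by rewrite /= E4 modn_small // inordK.
have ug : (u < g)%N by rewrite -[X in (_ < X)%N](Fp_cast g_pr).
by rewrite /= val_Fp_nat // Eg modn_small.
Qed.

Lemma residue_classK (M : nat) : class_repr (residue_class g M) = (M %% (4 * g))%N.
Proof.
have g4 : (0 < 4 * g)%N by rewrite muln_gt0 /= (prime_gt0 g_pr).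
rewrite -[LHS](@modn_small _ (4 * g)); last by rewrite /class_repr ltn_pmod.
apply/eqP; rewrite chinese_remainder // class_repr_mod4 class_repr_modg /=.
by rewrite inordK ?ltn_pmod // modn_mod eqxx val_Fp_nat ?modn_mod ?eqxx.
Qed.

(* The classes of M modulo 4 g for which a prime s^2 + M^2 has trace 2 s. *)
Definition good_class (s : int) (ju : 'I_4 * 'F_g) : bool :=
  ~~ (2 %| s + (ju.1 : nat)%:Z)%Z &&
  ((s%:~R ^+ 2 + ju.2 ^+ 2 != 0) &&
   (qratio I g (f s%:~R) (f ju.2) == I ^ quartic_exp g s (ju.1 : nat)%:Z)).

Lemma good_residue_class (s : int) (M : nat) :
  good_class s (residue_class g M) =
  [&& ~~ (2 %| s + M%:Z)%Z, ~~ (g%:Z %| s ^+ 2 + M%:Z ^+ 2)%Z &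
      qratio I g s%:~R M%:~R == I ^ quartic_exp g s M%:Z].
Proof.
rewrite /good_class /= inordK ?ltn_pmod //; congr [&& _, _ & _].
- lia.
- by rewrite -(Fp_int_eq0 g_pr) rmorphD !rmorphXn.
- rewrite rmorph_int rmorph_nat pmulrn; congr (_ == _).
  by apply/(sqrtN1_exprz_eq I2 K2); apply: quartic_exp_mod4; lia.
Qed.

Lemma card_good_class (s : int) : ~~ (g%:Z %| s)%Z ->
  2 * #|[set ju | good_class s ju]|%:Z = g%:Z - 1 - legendre (-1) g + delta g (2 * s).
Proof.
move=> gs; have s0 : s%:~R != 0 :> 'F_g by rewrite Fp_int_eq0.
have e4 (e : int) : (I ^ e) ^+ 4 = 1.
  by rewrite exprnP exprzAC -exprnP (sqrtN1_expr4 I2) exp1rz.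
have cardE (j : 'I_4) : (\sum_(u | good_class s (j, u)) 1)%N = class_count g s j.
  rewrite sum1dep_card /class_count /good_class /=; case: ifP => _ /=; first by rewrite cards0.
  rewrite (card_qratio I2 g_pr g_odd f) //; congr (_ - nat_of_bool _)%N.
  apply/eqP/idP => [|/(sqrtN1_exprz_eq I2 K2)].
    move=> E; apply/(sqrtN1_exprz_eq I2 K2).
    by rewrite -exprz_exp -(exprnP I 2) I2 -exprnP.
  by rewrite -exprz_exp -(exprnP I 2) I2 -exprnP.
have -> : #|[set ju | good_class s ju]| = (\sum_(j < 4) \sum_(u | good_class s (j, u)) 1)%N.
  by rewrite pair_big_dep /= sum1dep_card cardsE; apply: eq_card => -[].
rewrite (eq_bigr _ (fun j _ => cardE j)) !big_ord_recl big_ord0 addn0 !addnA.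
by rewrite (class_count_sum s g_odd g1) legendreN1.
Qed.

(* p = s^2 + M^2 with M = 4 g m + class_repr ju and m >= 1, expanded in m. *)
Definition class_prime (s : int) (ju : 'I_4 * 'F_g) (p : nat) : Prop :=
  exists m : int, (1 <= m) /\ p%:Z = (16 * g ^ 2)%N%:Z * m ^+ 2
    + (8 * g * class_repr ju)%N%:Z * m + (s ^+ 2 + (class_repr ju ^ 2)%N%:Z).

Lemma class_primeP (s : int) ju p : class_prime s ju p ->
  exists2 M : nat, residue_class g M = ju & s ^+ 2 + M%:Z ^+ 2 = p%:Z.
Proof.
case=> m []; case: m => [m|//] _ pE; exists (4 * g * m + class_repr ju)%N.
  by apply: class_reprK; rewrite mulnC modnMDl.
by rewrite pE -!mulnn !PoszD !PoszM; ring.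
Qed.

Lemma class_prime_uniq (s : int) (p : nat) ju ju' :
  class_prime s ju p -> class_prime s ju' p -> ju = ju'.
Proof.
move=> /class_primeP[M <- ME] /class_primeP[M' <- ME']; congr residue_class.
have : (M ^ 2 = M' ^ 2)%N.
  apply/eqP; rewrite -eqz_nat -!mulnn !PoszM -!expr2; apply/eqP.
  by apply: (addrI (s ^+ 2)); rewrite ME ME'.
by move/eqP; rewrite eqn_exp2r // => /eqP.
Qed.

Lemma class_prime_intro (s : int) (p M : nat) : s ^+ 2 + M%:Z ^+ 2 = p%:Z ->
  (4 * g <= M)%N -> class_prime s (residue_class g M) p.
Proof.
move=> pE gM; exists (M %/ (4 * g))%N%:Z; split.
  by rewrite lez_nat divn_gt0 ?gM // muln_gt0 /= (prime_gt0 g_pr).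
rewrite residue_classK -pE {1}(divn_eq M (4 * g)) -!mulnn !PoszD !PoszM.
by ring.
Qed.

Section LargePrime.

(** The bound ensures p > 3, p > g, and |m| >= 4 g whenever p = s^2 + m^2. *)
Context {p : nat} {s : int} (p_pr : prime p) (s0 : s != 0)
  (p_large : (`|s| ^ 2 + (4 * g) ^ 2 + 5 <= p)%N).

Let p_gt3 : (3 < p)%N. Proof. by move: p_large; lia. Qed.

Let png : ~~ (p %| g)%N.
Proof.
apply/negP => /dvdn_leq; rewrite (prime_gt0 g_pr) => /(_ isT).
by move: p_large; rewrite -!mulnn; nia.
Qed.

Let pg : p != g. Proof. by apply: contraNneq png => ->. Qed.

Let p_odd : odd p.
Proof. by case: (even_prime p_pr) => // p2; move: p_gt3; rewrite p2. Qed.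

Let exists_prim_root : exists z : K, p.-primitive_root z.
Proof.
apply: closed_prim_root => //; rewrite -(dvdn_pcharf gK) dvdn_prime2 //.
by rewrite eq_sym.
Qed.

Let trace_eq : frobenius_trace (curve_E g) p = 2 * s <->
  \sum_(x : 'F_p) phi (x ^+ 3 - g%:R * x) = - 2 * s.
Proof.
have [_ ->] := frobenius_trace_curve_E p_pr p_gt3 png.
by split=> [E|->]; [rewrite -[LHS]opprK E; ring | ring].
Qed.

Lemma class_of_trace : frobenius_trace (curve_E g) p = 2 * s ->
  exists2 ju, good_class s ju & class_prime s ju p.
Proof.
move=> /trace_eq tr.
(* The primes 3 mod 4 have trace 0, which differs from 2 s as s != 0. *)
have p4 : (p %% 4 = 1)%N.
  apply/eqP; apply: contraTT isT => p4.
  have p3 : (p %% 4 = 3)%N by apply: odd_mod4_neq1 => //; apply/eqP.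
  move: tr; rewrite (trace_sum_eq0 g p p_pr p3) => E.
  by move: s0; rewrite -(inj_eq (mulfI (isT : - 2 != 0 :> int))) mulr0 -E eqxx.
have [z zP] := exists_prim_root.
have gp0 : g%:R != 0 :> 'F_p by rewrite -(dvdn_pcharf (pchar_Fp p_pr)).
have [m sm] := trace_sum_two_squares p_pr p4 gp0 tr.
pose M := `|m|%N.
have sM : s ^+ 2 + M%:Z ^+ 2 = p%:Z by rewrite -sm abszE real_normK ?num_real.
have crit := trace_criterion I2 gK g_odd p_pr p4 pg zP s M s0 sM.
exists (residue_class g M); last first.
  apply: class_prime_intro => //; apply: (two_squares_ge sM).
  by apply: leq_trans p_large; apply: leq_addr.
rewrite good_residue_class; apply/and3P; split.
- apply/negP => sM2; have : (2 %| p%:Z)%Z.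
    have -> : p%:Z = (s + M%:Z) * (s - M%:Z) + 2 * M%:Z ^+ 2 by rewrite -sM; ring.
    by rewrite rpredD ?dvdz_mulr.
  by rewrite dvdzE /= dvdn2 p_odd.
- by rewrite sM dvdzE /= dvdn_prime2 // eq_sym.
- by apply/eqP/crit.
Qed.

Lemma trace_of_class ju : good_class s ju -> class_prime s ju p ->
  good_reduction (curve_E g) p /\ frobenius_trace (curve_E g) p = 2 * s.
Proof.
move=> good /class_primeP[M ME sM]; move: good; rewrite -ME good_residue_class.
case/and3P=> sM2 _ /eqP crit.
have [good_p _] := frobenius_trace_curve_E p_pr p_gt3 png.
split=> //; apply/trace_eq.
have p4 := odd_two_squares_mod4 sM sM2.
have [z zP] := exists_prim_root.
by apply/(trace_criterion I2 gK g_odd p_pr p4 pg zP s M s0 sM).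
Qed.

End LargePrime.

(** Goodness supplies the hypotheses of (HL): s^2 + t^2 is odd and prime to g, hence prime to 16
    g^2. The discriminant is negative because s != 0, so it is no square. *)
Lemma pi_quad_class {R : realType} (s : int) ju : HL R -> s != 0 -> good_class s ju ->
  (fun x : R => (prime_count (class_prime s ju) x)%:R : R) ~_(pinfty_nbhs R)
  (fun x => 1 / (2 * (g%:R - 1)) *
    prime_prod (fun p => ~~ (p%:Z %| 2 * g%:Z * s)%Z)
      (fun p => 1 - (legendre (-1) p)%:~R / (p%:R - 1)) * sqrt_log x).
Proof.
move=> hl s0 good; rewrite -(HL_const_class g_pr g_odd s (class_repr ju)).
have : good_class s (residue_class g (class_repr ju)) by rewrite (class_reprK ju).
rewrite good_residue_class => /and3P[c2 cg _].
set t := class_repr ju in c2 cg *; set c := s ^+ 2 + (t ^ 2)%N%:Z.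
have cE : c = s ^+ 2 + t%:Z ^+ 2 by rewrite /c -mulnn PoszM.
have codd : ~~ (2 %| c)%Z.
  have -> : c = (s + t%:Z) ^+ 2 - 2 * (s * t%:Z) by rewrite cE; ring.
  have : (2 %| 2 * (s * t%:Z))%Z by rewrite dvdz_mulr.
  by have := odd_sqr_mod8 _ c2; lia.
apply: (hl (16 * g ^ 2)%N%:Z (8 * g * t)%N%:Z c).
- by rewrite ltz_nat muln_gt0 expn_gt0 (prime_gt0 g_pr).
- case=> n nE; have := sqr_ge0 n; rewrite -nE leNgt => /negP; apply.
  have -> : (8 * g * t)%N%:Z ^+ 2 - 4 * (16 * g ^ 2)%N%:Z * c = - (8 * g%:Z * s) ^+ 2.
    by rewrite cE -!mulnn !PoszM; ring.
  by rewrite oppr_lt0 exprn_even_gt0 //= !mulf_neq0 // eqz_nat -lt0n prime_gt0.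
- rewrite /gcdz /=; congr Posz; apply/eqP.
  have : coprime (16 * g ^ 2) `|c|.
    have c2' : coprime 2 `|c| by rewrite prime_coprime //; move: codd; rewrite dvdzE.
    have cg' : coprime g `|c| by rewrite prime_coprime //; move: cg; rewrite -cE dvdzE.
    by rewrite coprimeMl (coprimeXl 4 c2') (coprimeXl 2 cg').
  by apply: coprime_dvdl; apply: dvdn_gcdl.
- by rewrite negb_and codd orbT.
Qed.

End Classes.

(** * Summation of the (HL) asymptotics over the good classes *)

Theorem corollary1p8 (R : realType) (g : nat) (g_prime : prime g)
  (g_odd : odd g) (r : int) (r_even : (2 %| r)%Z) (gNr : ~~ (g%:Z %| r)%Z) :
  HL R ->
  asymp_sqrt_log (fun x : R => (pi_trace (curve_E g) r x)%:R)
    (1 / 4 * (1 + (delta g r)%:~R / (g%:R - 1 - (legendre (-1) g)%:~R))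
     * prime_prod (fun p => ~~ (p%:Z %| r)%Z)
         (fun p => 1 - (legendre (-1) p)%:~R / (p%:R - 1))).
Proof.
move=> hl; have g1 := prime_gt1 g_prime.
have [K [f _]] := countable_algebraic_closure 'F_g.
have [I I2] := @closed_sqrtN1 K.
have [s rE] : exists s, r = 2 * s by exists (r %/ 2)%Z; lia.
rewrite {}rE {r r_even} in gNr *.
have gs : ~~ (g%:Z %| s)%Z by apply: contra gNr => gs; rewrite dvdz_mull.
have s0 : s != 0 by apply: contraNneq gs => ->; rewrite dvdz0.
pose A := [set ju | good_class (I := I) f s ju].
have [B hB] : exists B : R, forall x : R,
    `|(pi_trace (curve_E g) (2 * s) x)%:R
      - \sum_(ju in A) (prime_count (class_prime s ju) x)%:R| <= B.
  apply: (@prime_count_partition _ _ _ _ _ (`|s| ^ 2 + (4 * g) ^ 2 + 5)%N).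
  - move=> p p_pr p_large [_ tr].
    have [ju good ju_p] := class_of_trace g_prime g_odd I2 f p_pr s0 p_large tr.
    by exists ju; rewrite ?inE.
  - move=> p ju p_pr p_large; rewrite inE.
    exact: trace_of_class.
  - exact: class_prime_uniq.
have cardA := card_good_class g_prime g_odd I2 f s gs.
have good ju : ju \in A -> good_class (I := I) f s ju by rewrite inE.
have := asymp_sqrt_log_sum _ _ _ _ _ hB
  (fun ju juA => pi_quad_class g_prime g_odd I2 f s ju hl s0 (good ju juA)).
(* Put N = g - 1 - (-1/g). The left constant is (N + delta)/2 times 1/(2 (g - 1)); on the right, the
   Euler factor N/(g - 1) at g times 1/4 (1 + delta/N) is the same number. *)
congr asymp_sqrt_log; rewrite (target_prod g_prime g_odd s gNr) !mulrA; congr (_ * _).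
have gR1 := natr_sub1_neq0 R g1.
have gR2 := sub_legendreN1_neq0 R g_prime g_odd.
have cardR : #|A|%:R = (g%:R - 1 - (legendre (-1) g)%:~R + (delta g (2 * s))%:~R) / 2 :> R.
  have := congr1 (fun z : int => z%:~R : R) cardA => /= cardR.
  rewrite -[#|A|%:R](mulKf (_ : 2 != 0 :> R)) ?pnatr_eq0 // mulrC; congr (_ / _).
  transitivity ((2 * #|A|%:Z)%:~R : R); first by ring.
  by rewrite cardR; ring.
by rewrite cardR; field; rewrite gR1 gR2.
Qed.
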